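(* Let $p_n$ denote the $n$th prime and $d_n=p_{n+1}-p_n$, and for $k\ge1$ let $R_k=\limsup_{n\to\infty}\frac{\min(d_{n+1},\dots,d_{n+k})}{\log^2(p_n)}$. Assume that $0<R_1<\infty$ and $0<R_2<\infty$. Let $\delta=\delta_P$ and $\mu=\mu_P$ be the conformal measure on $\Lambda_P$. Then $0<\mathcal P^\psi(\mu)<\infty$ for $\psi(r)=r^\delta(\log\log(1/r))^{-2\delta}$.
   Context: For $E\subset\mathbb N$ and $a\in E$ let $\phi_a(x)=1/(a+x)$; for finite words $\omega$ put $\phi_\omega=\phi_{\omega_1}\circ\cdots\circ\phi_{\omega_{|\omega|}}$ and $\|\phi_\omega'\|=\sup_{[0,1]}|\phi_\omega'|$. $\Lambda_P$ is the set of irrationals in $(0,1)$ with all continued fraction entries prime. $\delta_P$ is the zero of the pressure $s\mapsto\lim_n\frac1n\log\sum_{\omega\in P^n}\|\phi_\omega'\|^s$ ($1/2<\delta_P<1$), and $\mu_P$ is the unique Borel probability measure on $\Lambda_P$ with $\mu_P(A)=\sum_{p\in P}\int_{\phi_p^{-1}(A)}|\phi_p'|^{\delta_P}d\mu_P$. For a dimension function $\psi$, $\mathcal P^\psi$ is the $\psi$-dimensional packing measure (defined from the packing premeasure $\widetilde{\mathcal P}^\psi(A)=\lim_{\epsilon\to0}\sup\sum_j\psi(\mathrm{diam}B_j)$ over disjoint balls centered in $A$ of diameter $\le\epsilon$, by $\mathcal P^\psi(A)=\inf\{\sum_i\widetilde{\mathcal P}^\psi(A_i):A\subset\bigcup A_i\}$),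 and $\mathcal P^\psi(\mu)=\inf\{\mathcal P^\psi(A):\mu(\mathbb R\setminus A)=0\}$. *)

(* Defs.v *)
From HB Require Import structures.
From mathcomp Require Import all_boot all_order all_algebra.
From mathcomp Require Import all_classical all_reals all_analysis.
Set Implicit Arguments. Unset Strict Implicit. Unset Printing Implicit Defensive.
Import Order.TTheory GRing.Theory Num.Theory.
Import numFieldNormedType.Exports.
Local Open Scope classical_set_scope.
Local Open Scope ring_scope.

Lemma next_prime_ex (m : nat) : exists q, (m < q)%N && prime q.
Proof. by case: (prime_above m) => q Hq Pq; exists q; rewrite Hq Pq. Qed.

Definition next_prime (m : nat) : nat := ex_minn (next_prime_ex m).

(* nth_prime 0 = 2, nth_prime 1 = 3, ... (0-indexed; irrelevant for limsup) *)
Fixpoint nth_prime (n : nat) : nat :=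
  if n is n'.+1 then next_prime (nth_prime n') else 2%N.

Definition gap (n : nat) : nat := (nth_prime n.+1 - nth_prime n)%N.

Definition mingap (k n : nat) : nat :=
  \big[minn/gap n.+1]_(1 <= i < k.+1) gap (n + i).

Definition Rk (R : realType) (k : nat) : \bar R :=
  limn_esup (fun n => ((mingap k n)%:R / (ln ((nth_prime n)%:R : R)) ^+ 2)%:E).

Definition phi (R : realType) (a : nat) : R -> R := fun x => 1 / (a%:R + x).

Fixpoint phiw (R : realType) (w : seq nat) : R -> R :=
  if w is a :: w' then @phi R a \o @phiw R w' else id.

Definition dnorm (R : realType) (w : seq nat) : R :=
  sup [set `|derive1 (@phiw R w) x| | x in `[0, 1]].

Definition Zsum (R : realType) (s : R) (n : nat) : \bar R :=
  \esum_(w in [set w : n.-tuple nat | all prime w]) ((@dnorm R w) `^ s)%:E.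

(* delta is the zero of the pressure s |-> lim_n (1/n) log Zsum s n
   (we require the partition sums to be finite, so the logarithms make sense) *)
Definition pressure_zero (R : realType) (s : R) : Prop :=
  (forall n, Zsum s n < +oo)%E /\
  (fun n : nat => ln (fine (Zsum s n)) / n%:R) @ \oo --> (0 : R).

Definition gauss (R : realType) (x : R) : R := 1 / x - (Num.truncn (1 / x))%:R.

(* the (n+1)-th continued fraction entry of x in (0,1) *)
Definition cf_entry (R : realType) (x : R) (n : nat) : nat :=
  Num.truncn (1 / iter n (@gauss R) x).

Definition irrational (R : realType) (x : R) : Prop := ~ (exists q : rat, x = ratr q).

Definition LambdaP (R : realType) : set R :=
  [set x | 0 < x < 1 /\ irrational x /\ forall n, prime (cf_entry x n)].

Definition conformal (R : realType) (delta : R)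
    (mu : {measure set R -> \bar R}) : Prop :=
  mu setT = 1%E /\ mu (~` @LambdaP R) = 0%E /\
  forall A : set R, measurable A ->
    mu A = (\sum_(p <oo | prime p)
               \int[mu]_(x in @phi R p @^-1` A) ((`|derive1 (@phi R p) x| `^ delta)%:E))%E.

(* S_eps(A) = sup of sum_j psi(diam B_j) over countable families of pairwise
   disjoint closed balls B_j = B(x_j, r_j) centred in A with diam B_j = 2 r_j <= eps *)
Definition packing_sums (R : realType) (psi : R -> R) (A : set R) (eps : R)
    : set (\bar R) :=
  [set e | exists (J : set nat) (x r : nat -> R),
      (forall j, J j -> A (x j) /\ 0 < r j /\ 2 * r j <= eps) /\
      (forall i j, J i -> J j -> i <> j ->
         closed_ball (x i) (r i) `&` closed_ball (x j) (r j) = set0) /\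
      e = (\esum_(j in J) (psi (2 * r j))%:E)%E].

(* packing premeasure: lim_{eps -> 0} S_eps(A) = inf_{eps > 0} S_eps(A) (S_eps is monotone) *)
Definition packing_pre (R : realType) (psi : R -> R) (A : set R) : \bar R :=
  ereal_inf [set ereal_sup (packing_sums psi A eps) | eps in [set e : R | 0 < e]].

Definition packing_measure (R : realType) (psi : R -> R) (A : set R) : \bar R :=
  ereal_inf [set (\sum_(i <oo) packing_pre psi (B i))%E | B in
               [set B : nat -> set R | A `<=` \bigcup_i B i]].

Definition packing_of_measure (R : realType) (psi : R -> R)
    (mu : {measure set R -> \bar R}) : \bar R :=
  ereal_inf [set packing_measure psi A | A in
               [set A : set R | measurable A /\ mu (~` A) = 0%E]].

Definition psi_dim (R : realType) (delta : R) (r : R) : R :=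
  r `^ delta * (ln (ln (1 / r))) `^ (- (2 * delta)).

(* Main.v *)
Require Import Defs.
From HB Require Import structures.
From mathcomp Require Import all_boot all_order all_algebra.
From mathcomp Require Import all_classical all_reals all_analysis.
From mathcomp Require Import measurable_realfun ring lra zify.
Import Order.TTheory GRing.Theory Num.Theory.
Import numFieldNormedType.Exports.
Local Open Scope classical_set_scope.
Local Open Scope ring_scope.
Set Implicit Arguments.
Unset Strict Implicit.
Unset Printing Implicit Defensive.

(** Two density theorems reduce the claim to the mass of small balls. If almost every x has
    arbitrarily small r with mu(B(x,5r)) <= c psi(2r), a Vitali covering shows that every set
    carrying mu has packing measure at least 1/c ([packing_lower]). If almost every x satisfies
    psi(2r) <= c mu(B(x,r/2)) for all small r, an exhaustion by closed pieces gives a set carrying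
    mu of packing measure at most 2c ([packing_upper]).

    Balls are studied after renormalisation. Let w be the first n digits of x, q the continuant of w
    and p the next digit. The map phi_w contracts by about q^-2, and conformality with bounded
    distortion gives phi_w(B) the mass q^(-2 delta) mu(B) up to a constant ([mass_cyl_le],
    [mass_cyl_ge]). So B(x,s) is compared with a ball of radius rho = s q^2 around T^n x, a point
    between 1/(p+1) and 1/p.

    Balls are never too light ([upper_density]). Choose n with p^-2 <= rho <= 4. Finiteness of R_1
    bounds the prime gaps by K log^2 p, so the ball contains the branches of enough primes to have
    mass at least a constant times (rho / log^2 p)^delta ([ball_mass]). By Borel-Cantelli p <=
    (n+1)^C for all large n ([digit_growth]), while q >= 2^n; hence log p is at most a constant
    times log log(1/s), which produces the factor (log log)^(-2 delta).

    Balls are light at some scales ([lower_density]). Positivity of R_2 gives infinitely many primes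
    p at distance at least g >= c log^2 p from all other primes ([isolated_primes]). Almost every x
    has, for arbitrarily large such p, the digit p at some place n < p^3 ([hitting]). A ball around
    such an x of radius about g/(p^2 q^2) meets the limit set in one branch only ([isolated_ball]),
    of mass at most a constant times (pq)^(-2 delta). As log q = O(n^2), log log(1/r) is O(log p),
    and this mass is at most a multiple of psi. *)

(** * Continuants and the Möbius maps phi_w *)

Section Continuants.
Variable R : realType.
Implicit Types (w : seq nat) (x y : R).

(** Numerator and denominator of phi_w(x), from 1/(a + u/v) = v/(u + a v). The value [qden] of the
    denominator at 0 is the classical continuant q_n. *)
Fixpoint cnd w x : R * R :=
  if w is a :: w' then ((cnd w' x).2, (cnd w' x).1 + a%:R * (cnd w' x).2)
  else (x, 1).

Definition num w x := (cnd w x).1.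
Definition den w x := (cnd w x).2.
Definition qden w := den w 0.

Lemma num_cons a w x : num (a :: w) x = den w x.
Proof. by []. Qed.

Lemma den_cons a w x : den (a :: w) x = num w x + a%:R * den w x.
Proof. by []. Qed.

(** The last clause is what makes the induction close: [num] alone is not within a factor 1 + x of
    its value at 0 (take the empty word), but [num] + [den] is. *)
Lemma cnd_bounds w x : all prime w -> 0 <= x ->
  [/\ 0 <= num w 0, num w 0 <= num w x, 1 <= qden w, qden w <= den w x &
   den w x <= (1 + x) * qden w /\
   num w x + den w x <= (1 + x) * (num w 0 + qden w)].
Proof.
move=> + x0; elim: w => [_|a w IH /=].
  by rewrite /num /qden /den /=; split; lra.
move=> /andP[/prime_gt1 a1 /IH[h1 h2 h3 h4 [h5 h6]]].
have a2 : 2 <= a%:R :> R by rewrite ler_nat.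
rewrite /qden !num_cons !den_cons -/(qden w); split; [| | | |split]; nra.
Qed.

Lemma qden_ge1 w : all prime w -> 1 <= qden w.
Proof. by move=> pw; have [] := cnd_bounds pw (lexx 0). Qed.

Lemma qden_cons a w : all prime w -> qden w != 0 /\ qden (a :: w) = (a%:R + num w 0 / qden w) * qden w.
Proof.
move=> /qden_ge1 D1; have D0 : qden w != 0 by lra.
by split=> //; rewrite mulrDl divfK// addrC.
Qed.

Lemma qden_size w : all prime w -> 2 ^+ size w <= qden w.
Proof.
elim: w => [_|a w IH /= /andP[/prime_gt1 a1 pw]]; first by rewrite expr0 lexx.
have [h1 _ h3 _ _] := cnd_bounds pw (lexx 0).
have a2 : 2 <= a%:R :> R by rewrite ler_nat.
have := IH pw; rewrite exprS /qden den_cons -/(qden w); nra.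
Qed.

(** Each digit acts by a matrix of determinant -1. *)
Lemma cnd_det w x y : `|num w x * den w y - num w y * den w x| = `|x - y|.
Proof.
elim: w => [|a w IH]; first by rewrite /num /den /= !mulr1.
rewrite !num_cons !den_cons -IH -[RHS]normrN; congr (`|_|); ring.
Qed.

Lemma mobius_dist w x y : all prime w -> 0 <= x -> 0 <= y ->
  `|num w x / den w x - num w y / den w y| = `|x - y| / (den w x * den w y).
Proof.
move=> pw x0 y0.
have [_ _ h1 h2 _] := cnd_bounds pw x0.
have [_ _ _ h3 _] := cnd_bounds pw y0.
have dx : 0 < den w x by lra.
have dy : 0 < den w y by lra.
rewrite -(cnd_det w x y) -[X in _ = _ / X](gtr0_norm (mulr_gt0 dx dy)) -normf_div.
by congr (`|_|); field; rewrite !gt_eqF.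
Qed.

Lemma mobius_dist_le w x y : all prime w -> 0 <= x -> 0 <= y ->
  `|num w x / den w x - num w y / den w y| <= `|x - y| / qden w ^+ 2.
Proof.
move=> pw x0 y0; rewrite mobius_dist//.
have [_ _ h1 h2 _] := cnd_bounds pw x0.
have [_ _ _ h3 _] := cnd_bounds pw y0.
rewrite ler_wpM2l// lef_pV2 ?posrE; nra.
Qed.

(** Appending a digit substitutes 1/(a + x) for x; the factor a + x clears the denominator. *)
Lemma cnd_rcons w a x : a%:R + x != 0 ->
  den (rcons w a) x = (a%:R + x) * den w (a%:R + x)^-1 /\
  num (rcons w a) x = (a%:R + x) * num w (a%:R + x)^-1.
Proof.
move=> ax; elim: w => [|b w [h1 h2]] /=.
  by rewrite /num /den /= mulfV// mulr1 addrC mulr1.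
by rewrite !num_cons !den_cons h1 h2; split=> //; ring.
Qed.

Lemma qden_rcons w a : all prime w -> prime a ->
  a%:R * qden w <= qden (rcons w a) <= 2 * a%:R * qden w.
Proof.
move=> pw /prime_gt1 a1; have a2 : 2 <= a%:R :> R by rewrite ler_nat.
have [|+ _] := @cnd_rcons w a 0; first by lra.
rewrite addr0 -/(qden _) => ->.
have i0 : 0 <= a%:R^-1 :> R by rewrite invr_ge0; lra.
have i1 : a%:R^-1 <= 1 :> R by rewrite invf_le1; lra.
have [_ _ h1 h2 [h4 _]] := cnd_bounds pw i0.
have h5 : den w a%:R^-1 <= 2 * qden w by nra.
have a0 : 0 <= a%:R :> R by [].
by rewrite [2 * _]mulrC -mulrA !ler_wpM2l.
Qed.

End Continuants.

(** * The Gauss map, digits, cylinders and their measurability *)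

Section Digits.
Variable R : realType.
Implicit Types (w : seq nat) (x y : R) (B : set R).
Local Notation X := (@LambdaP R).
Local Notation T := (@gauss R).
Local Notation digit := (@cf_entry R).

Lemma cf_entryS x n : digit x n.+1 = digit (T x) n.
Proof. by rewrite /cf_entry iterSr. Qed.

Lemma irrational_inv_sub x (q : rat) : Defs.irrational x ->
  Defs.irrational (1 / x - ratr q).
Proof.
move=> ix [s E]; apply: ix; exists (1 / (s + q))%R.
have -> : ratr (1 / (s + q)) = 1 / ratr (s + q) :> R by rewrite fmorph_div rmorph1.
by rewrite rmorphD /= -E subrK !div1r invrK.
Qed.

Lemma LambdaP_gauss x : X x ->
  [/\ 0 < x < 1, prime (digit x 0), X (T x) & x = ((digit x 0)%:R + T x)^-1].
Proof.
move=> [/andP[x0 x1] [ix px]].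
have := irrational_inv_sub (q := (digit x 0)%:R) ix; rewrite ratr_nat => iT.
have i0 : 0 <= 1 / x by rewrite divr_ge0 ?ltW.
have /andP[t0 t1] := truncn_itv i0.
have E : x = ((digit x 0)%:R + T x)^-1.
  by rewrite /gauss /cf_entry /= addrC subrK div1r invrK.
split=> //; first by rewrite x0.
split; last by split=> // n; rewrite -cf_entryS.
have -> /= : T x < 1 by rewrite /gauss ltrBlDr -natr1 addrC in t1 *.
rewrite andbT lt0r subr_ge0 t0 andbT.
(* Irrationality excludes T x = 0, so the orbit never leaves (0,1). *)
by apply/eqP => T0; apply: iT; exists 0%R; rewrite rmorph0 -T0.
Qed.

Lemma digitE p x : (0 < p)%N -> 0 < x < 1 -> digit (p%:R + x)^-1 0 = p /\
  T (p%:R + x)^-1 = x.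
Proof.
move=> p0 /andP[x0 x1]; suff E : digit (p%:R + x)^-1 0 = p.
  by split=> //; rewrite /gauss -/(cf_entry _ 0) E div1r invrK addrC addKr.
rewrite /cf_entry /= div1r invrK; apply: truncn_def.
by rewrite -natr1; lra.
Qed.

Lemma irrational_inv x p : Defs.irrational x -> Defs.irrational (p%:R + x)^-1.
Proof.
move=> ix [q E]; apply: ix; exists (q^-1 - p%:R)%R.
by rewrite rmorphB fmorphV /= -E invrK ratr_nat addrC addKr.
Qed.

Lemma LambdaP_phi p x : prime p -> X x -> X (p%:R + x)^-1.
Proof.
move=> pp [x01 [ix px]]; have p0 := prime_gt0 pp.
have [d0 T0] := digitE p0 x01.
have p1 : 1 <= p%:R :> R by rewrite ler1n.
have/andP[x0 x1] := x01.
split; first by rewrite invr_gt0 invf_lt1; lra.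
split; first exact: irrational_inv.
by case=> [|n]; rewrite ?d0// cf_entryS T0.
Qed.

Fixpoint pref n x : seq nat := if n is m.+1 then digit x 0 :: pref m (T x) else [::].

Lemma size_pref n x : size (pref n x) = n.
Proof. by elim: n x => //= n IH x; rewrite IH. Qed.

Lemma prefS n x : pref n.+1 x = rcons (pref n x) (digit x n).
Proof.
elim: n x => // n IH x; have := IH (T x); rewrite -cf_entryS => E.
by rewrite [RHS]/= -E.
Qed.

Lemma LambdaP_iter n x : X x -> X (iter n T x).
Proof. by move=> Xx; elim: n => //= n /LambdaP_gauss[]. Qed.

Lemma prime_pref n x : X x -> all prime (pref n x).
Proof.
by elim: n x => //= n IH x /LambdaP_gauss[_ -> XT _]; exact: IH.
Qed.

Lemma prime_digit n x : X x -> prime (digit x n).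
Proof. by move=> [_ [_]]. Qed.

Lemma LambdaP_mobius n x : X x ->
  x = num (pref n x) (iter n T x) / den (pref n x) (iter n T x).
Proof.
elim: n x => [|n IH] x Xx; first by rewrite /num /den /= divr1.
have [_ pd XT E] := LambdaP_gauss Xx.
rewrite iterSr [LHS]E {1}(IH _ XT) [pref _ _]/= num_cons den_cons.
set u := num _ _; set v := den _ _.
have v0 : v != 0.
  have [/andP[h _] _] := LambdaP_iter n XT.
  have [_ _ h1 h2 _] := cnd_bounds (prime_pref n XT) (ltW h).
  by rewrite gt_eqF// (lt_le_trans _ h2)// (lt_le_trans _ h1).
have -> : (digit x 0)%:R + u / v = (u + (digit x 0)%:R * v) / v.
  by field.
by rewrite invf_div.
Qed.

Lemma measurable_truncn : measurable_fun setT (fun x : R => (Num.truncn x)%:R : R).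
Proof.
apply: nondecreasing_measurable; first exact: measurableT.
by move=> x y xy; rewrite ler_nat; exact: le_truncn.
Qed.

(** Inversion as a real power, which is measurable on the whole line; it agrees with 1/x for x >= 0,
    hence [gm] agrees with the Gauss map there. *)
Let inv1 x : R := x `^ (-1).
Let gm x : R := inv1 x - (Num.truncn (inv1 x))%:R.

Let inv1E x : 0 <= x -> inv1 x = 1 / x.
Proof. by move=> x0; rewrite /inv1 powR_inv1// div1r. Qed.

Let gmE x : 0 <= x -> gm x = T x.
Proof. by move=> x0; rewrite /gm inv1E. Qed.

Let gauss_ge0 x : 0 <= x -> 0 <= T x.
Proof.
move=> x0; have /truncn_itv/andP[+ _] : 0 <= 1 / x by rewrite divr_ge0.
by rewrite subr_ge0.
Qed.

Let iter_gm n x : 0 <= x -> iter n gm x = iter n T x /\ 0 <= iter n T x.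
Proof. by move=> x0; elim: n => //= n [-> h]; rewrite gmE//; split=> //; exact: gauss_ge0. Qed.

Let measurable_inv1 : measurable_fun setT inv1.
Proof. exact: measurable_powR. Qed.

Let measurable_gm : measurable_fun setT gm.
Proof.
apply: measurable_funB; first exact: measurable_inv1.
exact: (measurableT_comp measurable_truncn measurable_inv1).
Qed.

Let measurable_iter_gm n : measurable_fun setT (iter n gm).
Proof.
elim: n => [|n IH]; first exact: measurable_id.
exact: (measurableT_comp measurable_gm IH).
Qed.

(** The irrationals are the complement of a countable set, and each digit condition is the preimage
    of a countable set under a measurable function. *)
Lemma measurable_LambdaP : measurable X.
Proof.
have -> : X = `]0, 1[%classic `&` (~` range (@ratr R)) `&`
   \bigcap_n ((fun x => (Num.truncn (inv1 (iter n gm x)))%:R : R) @^-1`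
     [set q%:R | q in [set q | prime q]]).
  apply/seteqP; split=> [x [x01 [ix px]]|x [[/=]]].
    have x0 : 0 <= x by case/andP: x01 => /ltW.
    split; first split=> /=; first by rewrite in_itv.
      by move=> [q _ E]; apply: ix; exists q.
    move=> n _ /=; have [-> h] := iter_gm n x0; rewrite inv1E//.
    by exists (digit x n) => //; exact: px.
  rewrite in_itv/= => x01 ix px; split=> //.
  have x0 : 0 <= x by case/andP: x01 => /ltW.
  split=> [[q E]|n]; first by apply: ix; exists q.
  have [q pq] := px n I.
  have [-> h] := iter_gm n x0; rewrite inv1E// => /eqP.
  by rewrite eqr_nat => /eqP qE; rewrite /cf_entry -qE.
apply: measurableI; first apply: measurableI.
- exact: measurable_itv.
- apply: measurableC; apply: countable_measurable => //.
  exact: sub_countable (card_image_le _ _) (countableP _).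
apply: bigcap_measurable => // n _.
rewrite -[_ @^-1` _]setTI.
have -> : (fun x => (Num.truncn (inv1 (iter n gm x)))%:R : R) =
  (fun x => (Num.truncn x)%:R) \o (inv1 \o iter n gm) by [].
apply: (measurableT_comp measurable_truncn (measurableT_comp measurable_inv1 (measurable_iter_gm n))) => //.
apply: countable_measurable => //.
exact: sub_countable (card_image_le _ _) (countableP _).
Qed.

Lemma measurable_digit_gauss a B : measurable B ->
  measurable [set x | X x /\ digit x 0 = a /\ B (T x)].
Proof.
move=> mB.
have -> : [set x | X x /\ digit x 0 = a /\ B (T x)] =
  X `&` ((fun x => (Num.truncn (inv1 x))%:R) @^-1` [set a%:R : R]) `&` (gm @^-1` B).
  apply/seteqP; split=> x [].
    move=> Xx; have [/andP[/ltW x0 _] _] := Xx.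
    rewrite /cf_entry /= => -[<- h].
    by split; [split=> //=; rewrite inv1E|rewrite /= gmE].
  move=> [Xx]; have [/andP[/ltW x0 _] _] := Xx.
  rewrite /= gmE// inv1E// => /eqP; rewrite eqr_nat => /eqP h hB.
  by split.
apply: measurableI; first apply: measurableI.
- exact: measurable_LambdaP.
- rewrite -[_ @^-1` _]setTI.
  exact: (measurableT_comp measurable_truncn measurable_inv1).
- by rewrite -[_ @^-1` _]setTI; exact: measurable_gm.
Qed.

(** This is phi_w(X ∩ B), described through digits and the orbit so that it is measurable by
    pullback. *)
Definition cyl w B := [set x | X x /\ pref (size w) x = w /\ B (iter (size w) T x)].

Lemma cyl_nil B : cyl [::] B = X `&` B.
Proof. by apply/seteqP; split=> [x []|x []]; rewrite /cyl/=; tauto. Qed.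

Lemma cyl_cons a w B :
  cyl (a :: w) B = [set x | X x /\ digit x 0 = a /\ cyl w B (T x)].
Proof.
apply/seteqP; split=> x [Xx]; have [_ _ XT _] := LambdaP_gauss Xx.
  by move=> [] /= [-> h1]; rewrite -iterS iterSr => h2; split.
by move=> [h [_ [h1 h2]]]; split=> //=; rewrite h h1 -iterS iterSr.
Qed.

Lemma measurable_cyl w B : measurable B -> measurable (cyl w B).
Proof.
move=> mB; elim: w => [|a w IH].
  by rewrite cyl_nil; apply: measurableI => //; exact: measurable_LambdaP.
by rewrite cyl_cons; exact: measurable_digit_gauss.
Qed.

End Digits.

(** * The conformal measure on first-level branches *)

Section Conformal.
Variables (R : realType) (delta : R) (mu : {measure set R -> \bar R}).
Hypothesis cmu : conformal delta mu.
Local Notation X := (@LambdaP R).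
Local Notation T := (@gauss R).
Local Notation digit := (@cf_entry R).

Definition mass A := fine (mu A).

Lemma mu_le1 A : measurable A -> (mu A <= 1)%E.
Proof.
by move=> mA; case: cmu => <- _; rewrite le_measure// inE.
Qed.

Lemma muE A : measurable A -> mu A = (mass A)%:E.
Proof.
move=> mA; rewrite /mass fineK// ge0_fin_numE//.
by rewrite (le_lt_trans (mu_le1 mA))// ltry.
Qed.

Lemma mass_ge0 A : 0 <= mass A.
Proof. exact: fine_ge0. Qed.

Lemma le_mass A B : measurable A -> measurable B -> A `<=` B -> mass A <= mass B.
Proof.
by move=> mA mB AB; rewrite -lee_fin -!muE// le_measure// inE.
Qed.

Lemma mass_le1 A : measurable A -> mass A <= 1.
Proof. by move=> mA; rewrite -lee_fin -muE// mu_le1. Qed.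

Lemma mass0 : mass set0 = 0.
Proof. by rewrite /mass measure0. Qed.

Lemma mass_setID A B : measurable A -> measurable B ->
  mass A = mass (A `\` B) + mass (A `&` B).
Proof.
move=> mA mB; apply: EFin_inj; rewrite EFinD -!muE//.
- exact: measureDI.
- exact: measurableI.
- exact: measurableD.
Qed.

Lemma mass_LambdaP : mass X = 1.
Proof.
have mX := @measurable_LambdaP R.
have [h1 [h2 _]] := cmu.
have := mass_setID measurableT mX.
rewrite setTD setTI /mass h1 h2 /= add0r => <-//.
Qed.

(** The density |phi_p'(y)|^delta; see [derive1_phi]. *)
Definition weight p (y : R) : R := (p%:R + y) `^ (- (2 * delta)).

Lemma measurable_weight p : measurable_fun setT (weight p).
Proof.
apply: (measurableT_comp (@measurable_powR R _)).
by apply: measurable_funD => //; exact: measurable_cst.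
Qed.

Let phiE p (y : R) : phi p y = (p%:R + y)^-1.
Proof. by rewrite /phi div1r. Qed.

Lemma derive1_phi p (y : R) : 0 < p%:R + y ->
  `|derive1 (@phi R p) y| `^ delta = weight p y.
Proof.
move=> h; have -> : @phi R p = (fun y => (p%:R + y)^-1).
  by apply/funext => z; rewrite phiE.
have d1 : is_derive y 1 (fun z : R => p%:R + z) 1.
  have := @is_deriveD R R^o R^o (cst p%:R) id y 1 0 1 (is_derive_cst _ _ _) (is_derive_id _ _).
  by rewrite add0r.
have d2 := @is_deriveV R (fun z : R => p%:R + z) y 1 1 (lt0r_neq0 h) d1.
have [_ d3] := d2.
rewrite derive1E d3 /GRing.scale /= mulr1 normrN ger0_norm.
  rewrite -[X in X `^ _]powR_inv1 ?exprn_ge0 ?ltW// -powR_mulrn ?ltW//.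
  by rewrite -!powRrM /weight; congr (_ `^ _); ring.
by rewrite invr_ge0 exprn_ge0// ltW.
Qed.

Definition branch p S : set R := [set x | X x /\ digit x 0 = p /\ S (T x)].

Lemma measurable_branch p S : measurable S -> measurable (branch p S).
Proof. exact: measurable_digit_gauss. Qed.

Lemma branch_itv q (z : R) : prime q -> branch q X z ->
  (q%:R + 1)^-1 <= z <= q%:R^-1.
Proof.
move=> /prime_gt1 q1 [Xz [dz XT]]; have [_ _ _ ->] := LambdaP_gauss Xz.
rewrite dz; have [/andP[t0 t1] _] := XT.
have q2 : 2 <= q%:R :> R by rewrite ler_nat.
by apply/andP; split; rewrite lef_pV2 ?posrE; lra.
Qed.

Let measurable_phi_preimage q A : measurable A -> A `<=` X ->
  measurable (@phi R q @^-1` A).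
Proof.
move=> mA AX.
have -> : @phi R q @^-1` A = `]- q%:R, +oo[%classic `&`
    ((fun y => (q%:R + y) `^ (-1)) @^-1` A).
  apply/seteqP; split=> y /=; rewrite phiE in_itv/= andbT.
    move=> Ay; have [/andP[+ _] _] := AX _ Ay.
    rewrite invr_gt0 => h; split; first by rewrite -subr_gt0 opprK addrC.
    by rewrite powR_inv1// ltW.
  move=> [h]; rewrite powR_inv1//; lra.
apply: measurableI; first exact: measurable_itv.
rewrite -[_ @^-1` _]setTI; apply: (measurableT_comp (@measurable_powR R _)) => //.
by apply: measurable_funD => //; exact: measurable_cst.
Qed.

(** In the conformality identity for [branch p S] only the summand of p survives, because phi_q(y)
    with y in X has first digit q. *)
Lemma mu_branch p S : prime p -> measurable S -> S `<=` X ->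
  mu (branch p S) = (\int[mu]_(x in S) (weight p x)%:E)%E.
Proof.
move=> pp mS SX; have mX := @measurable_LambdaP R.
have mA := measurable_branch p mS.
have AX : branch p S `<=` X by move=> x [].
have [_ [h2 ->//]] := cmu.
have I q : prime q -> (\int[mu]_(x in @phi R q @^-1` branch p S)
    ((`|derive1 (@phi R q) x| `^ delta)%:E) =
    \int[mu]_(x in if q == p then S else set0) (weight q x)%:E)%E.
  move=> pq; have mD := measurable_phi_preimage q mA AX.
  rewrite (eq_integral (fun x => (weight q x)%:E)); last first.
    move=> y; rewrite inE /= => Dy; rewrite derive1_phi//.
    by have [/andP[+ _] _] := AX _ Dy; rewrite phiE invr_gt0.
  (* Points outside X may be mapped into the branch as well; they form a null set and are
     dropped. *)
  rewrite (@ge0_negligible_integral _ _ _ _ _ (~` X))//; last 3 first.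
  - exact: measurableC.
  - apply: measurableT_comp => //; apply: measurable_funTS.
    exact: measurable_weight.
  - by move=> y _; rewrite lee_fin powR_ge0.
  congr (integral _ _ _); apply/seteqP; split=> y /=.
    move=> [/= h /contrapT Xy].
    have [/= d1 d2] := digitE (prime_gt0 pq) Xy.1.
    move: h; rewrite /branch phiE /= d1 d2 => -[_ [-> Sy]].
    by rewrite eqxx.
  case: eqP => // -> Sy; split; last by move/(_ (SX _ Sy)).
  have [/= d1 d2] := digitE (prime_gt0 pp) (SX _ Sy).1.
  rewrite /branch phiE /= d1 d2; split=> //.
  exact: LambdaP_phi (SX _ Sy).
rewrite (nneseriesD1 _ pp); last by move=> k pk; exact: integral_ge0.
rewrite I// eqxx eseries0 ?adde0//.
by move=> i _ /andP[pi /negPf ip]; rewrite I// ip integral_set0.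
Qed.

Lemma mass_branch_le p S u : prime p -> measurable S -> S `<=` X ->
  (forall x, S x -> weight p x <= u) -> mass (branch p S) <= u * mass S.
Proof.
move=> pp mS SX Su; rewrite -lee_fin EFinM -!muE//; last exact: measurable_branch.
rewrite mu_branch// -integral_cst//; apply: ge0_le_integral => //.
- by move=> x _; rewrite lee_fin powR_ge0.
- by apply: measurableT_comp => //; apply: measurable_funTS; exact: measurable_weight.
Qed.

Lemma mass_branch_ge p S l : prime p -> measurable S -> S `<=` X -> 0 <= l ->
  (forall x, S x -> l <= weight p x) -> l * mass S <= mass (branch p S).
Proof.
move=> pp mS SX l0 Su; rewrite -lee_fin EFinM -!muE//; last exact: measurable_branch.
rewrite mu_branch// -integral_cst//; apply: ge0_le_integral => //.
by apply: measurableT_comp => //; apply: measurable_funTS; exact: measurable_weight.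
Qed.

End Conformal.

(** * Lower bound for the packing measure from light balls *)

Section Packing.
Variables (R : realType) (mu : {measure set R -> \bar R}) (psi : R -> R) (c : R).
Hypotheses (mu1 : mu setT = 1%E) (psi0 : forall r, 0 <= psi r) (c0 : 0 < c).

Lemma esum_bigcup_le (F : nat -> set R) (D : set nat) (f : nat -> R) :
  (forall i, D i -> measurable (F i)) ->
  (forall i, D i -> (mu (F i) <= (c * f i)%:E)%E) -> (forall i, 0 <= f i) ->
  (mu (\bigcup_(i in D) F i) <= c%:E * \esum_(i in D) (f i)%:E)%E.
Proof.
move=> mF Fle f0.
pose G i := if i \in D then F i else set0.
have mG i : measurable (G i).
  by rewrite /G; case: ifPn => // /set_mem/mF.
have GE : \bigcup_(i in D) F i = \bigcup_i G i.
  by rewrite /G -bigcup_mkcond.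
rewrite GE; apply: (le_trans (measure_sigma_subadditive mu mG _ (@subset_refl _ (\bigcup_i G i)))).
  exact: bigcup_measurable.
have DE : [set i | i \in D] = D by apply/seteqP; split=> i /=; rewrite inE.
rewrite -[X in (\esum_(i in X) _)%E]DE.
rewrite -nneseries_esum; last by move=> i _; rewrite lee_fin.
rewrite -nneseriesZl; last by move=> i _; rewrite lee_fin.
rewrite [leRHS]eseries_mkcond; apply: lee_nneseries => // i _.
rewrite /G; case: ifPn => [/set_mem Di|_]; last by rewrite measure0.
by rewrite -EFinM; exact: Fle.
Qed.

(** Vitali's lemma extracts disjoint balls B(x,r), an admissible packing, whose enlargements B(x,5r)
    still cover B; the hypothesis bounds the mass of each enlargement by the packing summand. *)
Lemma packing_covering (B : set R) (eps : R) : 0 < eps ->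
  (forall x, B x -> exists r, [/\ 0 < r, 2 * r <= eps &
     (mu (closed_ball x (5 * r)) <= (c * psi (2 * r))%:E)%E]) ->
  exists U : set R, [/\ measurable U, B `<=` U &
    (mu U <= c%:E * ereal_sup (packing_sums psi B eps))%E].
Proof.
move=> e0 Br.
have /choice[r Pr] : forall x, exists r, B x -> [/\ 0 < r, 2 * r <= eps &
     (mu (closed_ball x (5 * r)) <= (c * psi (2 * r))%:E)%E].
  move=> x; have [Bx|nBx] := pselect (B x); last by exists 0.
  by have [r hr] := Br x Bx; exists r.
(* The family of balls is indexed by all reals, so points outside B get a dummy positive radius. *)
pose rad x := if pselect (B x) is left _ then r x else 1.
have rad0 x : 0 < rad x by rewrite /rad; case: pselect => // /Pr[].
have radB x : B x -> rad x = r x by rewrite /rad; case: pselect.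
pose ba x := ball x (rad x).
have [|||D [cD DB tD covD]] := @vitali_lemma_infinite_cover R R ba B eps.
- by move=> x; exact: is_ball_ball.
- by move=> x; rewrite radius_ball_num// ltW.
- move=> x Bx; rewrite radius_ball_num ?ltW// radB//.
  by have [h1 h2 _] := Pr _ Bx; lra.
have clE x : closure (ba x) = closed_ball x (rad x) by rewrite closure_ballE.
have [D0|/set0P[d0 Dd0]] := eqVneq D set0.
  exists set0; split=> //.
    move=> x Bx; have [y] : cover D ((closure \o scale_ball 5) \o ba) x.
      apply: covD; exists x => //=; rewrite clE; exact: closed_ballxx.
    by rewrite D0.
  rewrite measure0 mule_ge0 ?lee_fin ?(ltW c0)//.
  apply: ereal_sup_ubound; exists set0, (fun=> 0), (fun=> 0); split=> //.
  by split=> //; rewrite esum_set0.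
(* The selected centres are countable; [f] numbers them, and [x_] inverts [f], as packings are
   indexed by naturals. *)
have [f finj] := countable_injP _ cD.
pose J := f @` D.
pose x_ (j : nat) : R := xget d0 [set x | D x /\ f x = j].
have xf x : D x -> x_ (f x) = x.
  move=> Dx; rewrite /x_; case: xgetP => [y _ [Dy fy]|]; last by move/(_ x); case.
  by apply: finj; rewrite ?inE.
have JD j : J j -> D (x_ j) /\ f (x_ j) = j by move=> [x Dx <-]; rewrite xf.
exists (\bigcup_(j in J) closed_ball (x_ j) (5 * r (x_ j))); split.
- by apply: bigcup_measurable => j _; exact: measurable_closed_ball.
- move=> x Bx; have [y Dy] : cover D ((closure \o scale_ball 5) \o ba) x.
    apply: covD; exists x => //=; rewrite clE; exact: closed_ballxx.
  rewrite /= scale_ballE// closure_ballE radB; last exact: DB.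
  by move=> h; exists (f y); [exists y|rewrite xf].
apply: (le_trans (@esum_bigcup_le _ J (fun j => psi (2 * r (x_ j))) _ _ _)) => //.
- by move=> j _; exact: measurable_closed_ball.
- by move=> j /JD[/DB/Pr[]].
rewrite lee_pmul2l//; apply: ereal_sup_ubound.
exists J, x_, (r \o x_); split; last split => //.
  by move=> j /JD[/DB Bj _] /=; have [? ?] := Pr _ Bj; split.
move=> i j /JD[Di fi] /JD[Dj fj] ij /=.
rewrite -radB; last exact: DB.
rewrite -(radB (x_ j)); last exact: DB.
rewrite -!clE; apply: contrapT => /eqP/set0P h.
by apply: ij; rewrite -fi -fj; congr f; exact: tD.
Qed.

(** For any cover of A by sets B_i, each B_i minus N lies in a measurable set of mass at most c
    times its premeasure, up to e/2^(i+1). Summing gives 1 <= c times the sum of the premeasures,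
    plus e. *)
Lemma packing_lower (N : set R) : measurable N -> mu N = 0%E ->
  (forall x eps, ~ N x -> 0 < eps -> exists r, [/\ 0 < r, 2 * r <= eps &
     (mu (closed_ball x (5 * r)) <= (c * psi (2 * r))%:E)%E]) ->
  forall A, measurable A -> mu (~` A) = 0%E -> (c^-1%:E <= packing_measure psi A)%E.
Proof.
move=> mN N0 Nr A mA A0; apply: le_ereal_inf_tmp => _ [B AB <-].
have pre0 i : (0 <= packing_pre psi (B i))%E.
  apply: le_ereal_inf_tmp => _ [e _ <-]; apply: ereal_sup_ubound.
  exists set0, (fun=> 0), (fun=> 0); split=> //.
  by split=> //; rewrite esum_set0.
rewrite -[c^-1%:E]mule1 lee_pdivrMl//.
apply/lee_addgt0Pr => e e0.
have /choice[U PU] : forall i, exists U : set R, [/\ measurable U, B i `\` N `<=` U &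
    (mu U <= c%:E * packing_pre psi (B i) + (e / (2 ^ i.+1)%:R)%:E)%E].
  (* If the premeasure is infinite the whole line will do; otherwise pick eps where the packing
     supremum nearly attains the infimum. *)
  move=> i; have [->|] := eqVneq (packing_pre psi (B i)) +oo%E.
    by exists setT; split=> //; rewrite mulry gtr0_sg// mul1e addye// leey.
  move=> preoo; set d := e / _; have d0 : 0 < d by rewrite divr_gt0// ltr0n expn_gt0.
  have prefin : packing_pre psi (B i) \is a fin_num by rewrite ge0_fin_numE// ltey.
  have [_ [eps /= eps0 <-] epsd] := lb_ereal_inf_adherent (divr_gt0 d0 c0) prefin.
  have [x [Bx Nx]|U [mU BU hU]] := @packing_covering (B i `\` N) eps eps0.
    exact: Nr.
  exists U; split=> //; apply: (le_trans hU).
  apply: (@le_trans _ _ (c%:E * ereal_sup (packing_sums psi (B i) eps))%E).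
    rewrite lee_pmul2l ?lte_fin//; apply: ereal_sup_le => s [J [x [r [h1 h2]]]].
    exists J, x, r; split=> // j Jj.
    by have [[Bx _] h3] := h1 j Jj.
  apply: (@le_trans _ _ (c%:E * (packing_pre psi (B i) + (d / c)%:E))%E).
    by rewrite lee_pmul2l ?lte_fin// ltW.
  have dc0 : 0 <= d / c by rewrite divr_ge0 ?ltW.
  by rewrite ge0_muleDr// -EFinM [(c * _)%R]mulrC divfK ?gt_eqF.
have mAN : measurable (A `\` N) by exact: measurableD.
apply: (@le_trans _ _ (mu (A `\` N))).
  have E := measureDI mu measurableT mAN; rewrite setTI setTD in E.
  rewrite -mu1; apply: (@le_trans _ _ (mu (~` (A `\` N)) + mu (A `\` N))%E).
    by rewrite le_eqVlt; apply/orP; left; apply/eqP; exact: E.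
  rewrite -[leRHS]add0e leeD2r// setDE setCI setCK.
  have h := measureU2 mu (measurableC mA) mN.
  apply: (@le_trans _ _ (mu (~` A) + mu N)%E); first exact: h.
  have [a0 n0] : (mu (~` A) <= 0 /\ mu N <= 0)%E by rewrite A0 N0.
  by rewrite -[leRHS]adde0; exact: leeD.
apply: (@le_trans _ _ (\sum_(i <oo) mu (U i))%E).
  apply: measure_sigma_subadditive => //; first by move=> i; have [] := PU i.
  move=> x [Ax Nx]; have [i _ Bx] := AB _ Ax; exists i => //.
  by have [_ + _] := PU i; apply.
rewrite -nneseriesZl//.
apply: (le_trans _ (epsilon_trick _ _ (ltW e0))).
  by apply: lee_nneseries => // i _; have [] := PU i.
by move=> i; rewrite mule_ge0// lee_fin ltW.
Qed.

End Packing.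

(** * Upper bound for the packing measure from heavy balls *)

Section PackingUpper.
Variables (R : realType) (mu : {measure set R -> \bar R}) (psi : R -> R) (c : R).
Hypotheses (mu1 : mu setT = 1%E) (psi0 : forall r, 0 <= psi r) (c0 : 0 < c).
Implicit Types (S : set R) (k : nat).

(** The closure makes the set measurable. The radius r/2 leaves room for it: on the closure the same
    inequality holds with radius r, as [dense_atP] shows. *)
Let dense_at k : set R := closure [set x | forall r, 0 < r <= k.+1%:R^-1 ->
  ((psi (2 * r))%:E <= c%:E * mu (closed_ball x (r / 2)))%E].

Let far S k : set R := ~` \bigcup_(y in S) ball y (k.+1%:R^-1).

Let piece S k := dense_at k `&` far S k.

Let dense_atP k x r : dense_at k x -> 0 < r <= k.+1%:R^-1 ->
  ((psi (2 * r))%:E <= c%:E * mu (closed_ball x r))%E.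
Proof.
move=> Ex rk; have /andP[r0 _] := rk.
have r20 : 0 < r / 2 by rewrite divr_gt0.
have [y [Ey xy]] := Ex _ (nbhsx_ballx x _ r20).
apply: (le_trans (Ey _ rk)); rewrite lee_pmul2l ?lte_fin//.
apply: le_measure; rewrite ?inE; [exact: measurable_closed_ball..|].
move=> z; rewrite !closed_ballE// /closed_ball_ /= => yz.
move: xy; rewrite /ball /= => xy.
by rewrite (le_trans (ler_distD y _ _))// [r]splitr lerD// ltW.
Qed.

Let closed_piece S k : closed (piece S k).
Proof.
apply: closedI; first exact: closed_closure.
by apply: open_closedC; apply: bigcup_open => y _; exact: ball_open.
Qed.

(** Balls of diameter at most 1/(k+1) centred in [far S k] miss S. They are disjoint, so the sum of
    psi(2r) is at most c times the mass they share outside S. *)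
Let packing_pre_piece S k : closed S ->
  (packing_pre psi (piece S k) <= c%:E * mu (~` S))%E.
Proof.
move=> cS; apply: ge_ereal_inf.
have k0 : 0 < k.+1%:R^-1 :> R by rewrite invr_gt0.
exists (ereal_sup (packing_sums psi (piece S k) k.+1%:R^-1)).
  by exists k.+1%:R^-1.
apply: ge_ereal_sup => _ [J [x [r [h1 [h2 ->]]]]].
have JE : [set i | i \in J] = J by apply/seteqP; split=> i /=; rewrite inE.
rewrite -JE -nneseries_esum; last by move=> i _; rewrite lee_fin.
apply: (@le_trans _ _ (\sum_(i <oo | i \in J) (c%:E * mu (closed_ball (x i) (r i))))%E).
  apply: lee_nneseries => // i; first by rewrite lee_fin.
  move=> /set_mem Ji; have [[Ei _] [r0 rk]] := h1 _ Ji.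
  apply: (dense_atP Ei); rewrite r0/= (le_trans _ rk)//.
  by rewrite ler_peMl ?ltW// ltr1n.
rewrite nneseriesZl// lee_pmul2l ?lte_fin//.
have mB i : measurable (closed_ball (x i) (r i)) by exact: measurable_closed_ball.
rewrite -(@measure_bigcup _ _ _ mu J (fun i => closed_ball (x i) (r i)))//; last first.
  move=> i j Ji Jj /set0P; apply: contraNeq => /eqP ij; apply/eqP; exact: h2.
apply: le_measure; rewrite ?inE.
- by apply: bigcup_measurable.
- by apply: measurableC; exact: closed_measurable.
move=> z [i Ji]; have [[_ Fi] [r0 rk]] := h1 _ Ji.
rewrite closed_ballE// /closed_ball_ /= => xz Sz; apply: Fi; exists z => //.
rewrite /ball /= distrC (le_lt_trans xz)// (lt_le_trans _ rk)//.
by rewrite ltr_pMl ?ltr1n.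
Qed.

Hypotheses (N : set R) (mN : measurable N) (N0 : mu N = 0%E).
Hypothesis denseN : forall x, ~ N x -> exists2 e, 0 < e & forall r, 0 < r <= e ->
  ((psi (2 * r))%:E <= c%:E * mu (closed_ball x (r / 2)))%E.

Let inv_nat_lt (e : R) : 0 < e -> exists k : nat, forall n, (k <= n)%N -> n.+1%:R^-1 < e.
Proof.
move=> e0; exists (Num.truncn e^-1) => n kn.
rewrite invf_plt ?posrE// (lt_le_trans (truncnS_gt _))// ler_nat ltnS//.
Qed.

(** A point outside S and N lies in [piece S k] for all large k, since S is closed. So the uncovered
    sets decrease to a subset of N, and continuity from above applies. *)
Let remainder S (e : R) : closed S -> 0 < e ->
  exists k, (mu (~` (S `|` piece S k)) <= e%:E)%E.
Proof.
move=> cS e0; pose G k := ~` (S `|` piece S k).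
have mG k : measurable (G k).
  apply: measurableC; apply: closed_measurable; apply: closedU => //.
have Gni : {homo G : n m / (n <= m)%N >-> (n >= m)%O}.
  move=> n m nm; rewrite subsetEset; apply: subsetC; apply: setUS.
  have inm : m.+1%:R^-1 <= n.+1%:R^-1 :> R.
    by rewrite lef_pV2 ?posrE// ler_nat ltnS.
  apply: setISS.
    apply: closure_subset => x h r /andP[r0 rm]; apply: h.
    by rewrite r0 (le_trans rm).
  by apply: subsetC; apply: subset_bigcup => y _; exact: le_ball.
have IN : \bigcap_k G k `<=` N.
  move=> x Gx; apply: contrapT => Nx.
  have nS : ~ S x by move=> Sx; apply: (Gx 0%N I); left.
  have [e1 e10 he1] := denseN Nx.
  have oS : open (~` S) by exact: closed_openC.
  have /nbhs_ballP[e2 /= e20 he2] := open_nbhs_nbhs (conj oS nS).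
  have [k1 hk1] := inv_nat_lt e10.
  have [k2 hk2] := inv_nat_lt e20.
  apply: (Gx (maxn k1 k2) I); right; split.
    apply: subset_closure => r /andP[r0 rk]; apply: he1; rewrite r0 (le_trans rk)//.
    by rewrite ltW// hk1// leq_maxl.
  move=> [y Sy]; rewrite ball_symE => xy; apply: (he2 y) => //.
  by apply: le_ball xy; rewrite ltW// hk2// leq_maxr.
have I0 : mu (\bigcap_k G k) = 0%E.
  apply/eqP; rewrite -measure_le0 -N0 le_measure// inE//.
  exact: bigcapT_measurable.
apply: contrapT => /forallNP h.
have cG : mu (G k) @[k --> \oo] --> mu (\bigcap_k G k).
  apply: nonincreasing_cvg_mu => //; last exact: bigcapT_measurable.
  by rewrite (@le_lt_trans _ _ 1%E) ?ltry// -mu1 le_measure// inE.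
rewrite I0 in cG.
have : (e%:E <= 0)%E.
  by apply: (cvge_to_ge cG); apply: nearW => k; rewrite ltW// ltNge; apply/negP/h.
by rewrite lee_fin leNgt e0.
Qed.

(** Pieces are added one after another, so that mass at most 2^-n is left after n steps. The n-th
    piece has premeasure at most c times the mass left before it, and the sum of c 2^-n is 2c. *)
Lemma packing_upper : exists A, [/\ measurable A, mu (~` A) = 0%E &
  (packing_measure psi A <= (2 * c)%:E)%E].
Proof.
have /choice[K HK] : forall Se : set R * R, exists k, closed Se.1 -> 0 < Se.2 ->
    (mu (~` (Se.1 `|` piece Se.1 k)) <= Se.2%:E)%E.
  move=> [S e]; have [cS|nS] := pselect (closed S); last by exists 0%N.
  have [e0|ne] := pselect (0 < e); last by exists 0%N.
  by have [k hk] := remainder cS e0; exists k.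
pose tol (n : nat) : R := (2 ^ n)%:R^-1.
have tol0 n : 0 < tol n by rewrite invr_gt0 ltr0n expn_gt0.
pose S := fix S n := if n is n'.+1 then
  S n' `|` piece (S n') (K (S n', tol n)) else set0 : set R.
pose B n := piece (S n) (K (S n, tol n.+1)).
have SS n : S n.+1 = S n `|` B n by [].
have clS n : closed (S n).
  elim: n => [|n IH]; first exact: closed0.
  by rewrite SS; apply: closedU => //; exact: closed_piece.
have muS n : (mu (~` S n) <= (tol n)%:E)%E.
  case: n => [|n]; first by rewrite /= setC0 mu1 /tol expn0 invr1.
  exact: (HK (S n, tol n.+1) (clS n) (tol0 n.+1)).
exists (\bigcup_n S n).
have mS n : measurable (S n) by exact: closed_measurable.
have mU : measurable (\bigcup_n S n) by exact: bigcup_measurable.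
split=> //.
  apply/eqP; rewrite -measure_le0; apply/lee_addgt0Pr => e e0; rewrite add0e.
  have [k hk] := inv_nat_lt e0.
  apply: (@le_trans _ _ (mu (~` S k))).
    rewrite le_measure ?inE//; [exact: measurableC..|].
    by apply: subsetC; exact: bigcup_sup.
  apply: (le_trans (muS k)); rewrite lee_fin (le_trans _ (ltW (hk k (leqnn k))))//.
  by rewrite lef_pV2 ?posrE ?ltr0n ?expn_gt0// ler_nat ltn_expl.
apply: ge_ereal_inf; exists (\sum_(i <oo) packing_pre psi (B i))%E.
  exists B => //= x [n _]; elim: n => // n IH.
  by rewrite SS => -[/IH//|Bx]; exists n.
have c20 : 0 <= 2 * c by rewrite mulr_ge0 ?ltW.
apply: (le_trans _ (epsilon_trick0 xpredT c20)); apply: lee_nneseries => // i _.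
  move=> _; apply: le_ereal_inf_tmp => _ [e _ <-]; apply: ereal_sup_ubound.
  exists set0, (fun=> 0), (fun=> 0); split=> //.
  by split=> //; rewrite esum_set0.
apply: (le_trans (packing_pre_piece _ (clS i))).
have -> : (2 * c / (2 ^ i.+1)%:R)%:E = (c%:E * (tol i)%:E)%E.
  by rewrite -EFinM /tol expnS natrM; congr EFin; field; rewrite pnatr_eq0 expn_eq0.
by rewrite lee_pmul2l ?lte_fin.
Qed.

End PackingUpper.

Lemma nneseries_le_cst (R : realType) (u : nat -> \bar R) (c : \bar R) :
  (forall n, 0 <= u n)%E -> (forall N, \sum_(0 <= i < N) u i <= c)%E ->
  (\sum_(i <oo) u i <= c)%E.
Proof.
move=> u0 uc; apply: lime_le; first by apply: is_cvg_nneseries => n _ _.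
exact: nearW.
Qed.

Lemma powR_antimono (R : realType) (s a b : R) : 0 <= s -> 0 < a -> a <= b ->
  b `^ (- s) <= a `^ (- s).
Proof.
move=> s0 a0 ab; have b0 := lt_le_trans a0 ab.
by rewrite !powRN lef_pV2 ?posrE ?powR_gt0// ge0_ler_powR// nnegrE ltW.
Qed.

(** * Bounds for delta, bounded distortion and quasi-independence *)

Section Distortion.
Variables (R : realType) (delta : R) (mu : {measure set R -> \bar R}).
Hypothesis cmu : conformal delta mu.
Local Notation X := (@LambdaP R).
Local Notation T := (@gauss R).
Local Notation digit := (@cf_entry R).
Local Notation mass := (mass mu).
Local Notation mX := (@measurable_LambdaP R).

Lemma measurable_branchX p : measurable (branch p X).
Proof. by apply: measurable_branch; exact: mX. Qed.
Hint Resolve measurable_branchX : core.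

Lemma sum_branch_le (s : seq nat) A : uniq s -> measurable A ->
  (forall p, p \in s -> branch p X `<=` A) ->
  \sum_(p <- s) mass (branch p X) <= mass A.
Proof.
elim: s A => [|p s IH] A; first by rewrite big_nil mass_ge0.
move=> /= /andP[ps us] mA sA; rewrite big_cons (mass_setID cmu mA (measurable_branchX p)).
rewrite addrC lerD//.
  apply: IH => //; first exact: measurableD.
  move=> q qs x Bx; split; first by apply: sA Bx; rewrite inE qs orbT.
  by case: Bx => _ [qx _] [_ [px _]]; move: ps; rewrite -px qx qs.
apply: (le_mass cmu) => //; first exact: measurableI.
by move=> x Bx; split=> //; apply: sA Bx; rewrite mem_head.
Qed.

Lemma mass_le_sum_branch (s : seq nat) A : measurable A -> A `<=` X ->
  (forall x, A x -> digit x 0 \in s) ->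
  mass A <= \sum_(p <- s) mass (branch p X).
Proof.
elim: s A => [|p s IH] A mA AX As.
  rewrite big_nil; have -> : A = set0 by apply/seteqP; split=> x // /As.
  by rewrite mass0.
rewrite big_cons (mass_setID cmu mA (measurable_branchX p)) addrC lerD//.
  by apply: (le_mass cmu) => //; exact: measurableI.
apply: IH; first exact: measurableD.
  by move=> x [/AX].
move=> x [Ax Bx]; have := As _ Ax; rewrite inE => /predU1P[dx|//].
have [_ _ XT _] := LambdaP_gauss (AX _ Ax).
by exfalso; apply: Bx; split; [exact: AX|].
Qed.

Let weight_bounds p x : prime p -> X x -> 2 <= p%:R :> R /\ 0 < x < 1.
Proof. by move=> /prime_gt1 p1 [x01 _]; rewrite ler_nat. Qed.

(** If 2 delta <= 1, each branch has mass at least 1/(p+1), and 1/3 + 1/4 + 1/6 + 1/8 + 1/12 + 1/14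
    exceeds 1. *)
Lemma delta_gt_half : 1 < 2 * delta.
Proof.
rewrite ltNge; apply/negP => d1.
have h p : prime p -> (p%:R + 1)^-1 <= mass (branch p X).
  move=> pp; have p1 := prime_gt1 pp.
  rewrite -[leLHS]mulr1 -[Y in _ * Y <= _](mass_LambdaP cmu); apply: (mass_branch_ge cmu) => //.
    exact: mX.
  move=> x Xx; have [p2 /andP[x0 x1]] := weight_bounds pp Xx.
  apply: (@le_trans _ _ ((p%:R + x) `^ (- 1))).
    rewrite powR_inv1; last lra.
    by rewrite lef_pV2 ?posrE; lra.
  by apply: ler_powR; lra.
have := @sum_branch_le [:: 2; 3; 5; 7; 11; 13]%N X isT mX (fun _ _ _ B => B.1).
rewrite (mass_LambdaP cmu) leNgt => /negP; apply.
rewrite !big_cons big_nil addr0.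
have := h 2%N isT; have := h 3%N isT; have := h 5%N isT; have := h 7%N isT.
have := h 11%N isT; have := h 13%N isT.
rewrite !natr1.
move: (mass _) (mass _) (mass _) (mass _) (mass _) (mass _) => a b c d e f.
by move=> *; lra.
Qed.

Lemma mass_branchX_le p : prime p -> mass (branch p X) <= p%:R `^ (- (2 * delta)).
Proof.
move=> pp; rewrite -[leRHS]mulr1 -[Y in _ <= _ * Y](mass_LambdaP cmu).
apply: (mass_branch_le cmu) => //; first exact: mX.
move=> x Xx; have [p2 /andP[x0 x1]] := weight_bounds pp Xx.
by have d1 := delta_gt_half; apply: powR_antimono; lra.
Qed.

Lemma mass_branchX_ge p : prime p -> (2 * p%:R) `^ (- (2 * delta)) <= mass (branch p X).
Proof.
move=> pp; rewrite -[leLHS]mulr1 -[Y in _ * Y <= _](mass_LambdaP cmu).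
apply: (mass_branch_ge cmu) => //; first exact: mX.
move=> x Xx; have [p2 /andP[x0 x1]] := weight_bounds pp Xx.
by have d1 := delta_gt_half; apply: powR_antimono; lra.
Qed.

Lemma branch_not_prime p : ~~ prime p -> branch p X = set0.
Proof.
move=> np; apply/seteqP; split=> x // [[_ [_ /(_ 0%N) px]] [dx _]].
by move: np; rewrite -dx px.
Qed.

(** If delta > 1, the branches have total mass at most the sum of n^-2 over n >= 2, which is less
    than 1. *)
Lemma delta_le1 : delta <= 1.
Proof.
rewrite leNgt; apply/negP => d1.
(* A telescoping majorant of n^-2: 1/4 at n = 2 and 1/(n-1) - 1/n from 3 on, of total 3/4. *)
pose v (n : nat) : R := if n is n'.+3 then n'.+2%:R^-1 - n'.+3%:R^-1
  else if n is 2 then 4^-1 else 0.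
have v0 n : 0 <= v n.
  case: n => [|[|[|n]]] //=; rewrite subr_ge0 lef_pV2 ?posrE//.
  by rewrite ler_nat.
have hv n : (mu (branch n X) <= (v n)%:E)%E.
  have [pn|/branch_not_prime->] := boolP (prime n); last first.
    by rewrite measure0 lee_fin.
  rewrite (muE cmu)// lee_fin (le_trans (mass_branchX_le pn))//.
  have n0 : 1 <= n%:R :> R by rewrite ler1n prime_gt0.
  apply: (@le_trans _ _ (n%:R `^ (- 2%:R))); first by apply: ler_powR => //; lra.
  rewrite powR_invn//; case: n pn n0 {v0} => [|[|[|n]]] //= _ _.
    by rewrite -natrX.
  have -> : n.+2%:R^-1 - n.+3%:R^-1 = (n.+2%:R * n.+3%:R)^-1 :> R.
    by rewrite -!(natr1, natrM); field; rewrite !natr1 !pnatr_eq0.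
  by rewrite expr2 lef_pV2 ?posrE ?mulr_gt0// ler_pM2r// ler_nat.
have : (mu X <= (3 / 4)%:E)%E.
  apply: (@le_trans _ _ (\sum_(n <oo) mu (branch n X))%E).
    apply: measure_sigma_subadditive => //; first exact: mX.
    move=> x Xx; exists (digit x 0) => //; split=> //.
    by have [_ _ XT _] := LambdaP_gauss Xx.
  apply: nneseries_le_cst => // N.
  apply: (@le_trans _ _ (\sum_(0 <= n < N) (v n)%:E)%E); first exact: lee_sum.
  rewrite sumEFin lee_fin.
  have hN n : \sum_(0 <= i < n.+3) v i = 3 / 4 - n.+2%:R^-1.
    elim: n => [|n IH]; first by rewrite !big_nat_recr//= big_geq//; lra.
    by rewrite big_nat_recr//= IH; ring.
  apply: (@le_trans _ _ (\sum_(0 <= i < N.+3) v i)).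
    have mono n : \sum_(0 <= i < n) v i <= \sum_(0 <= i < n.+1) v i.
      by rewrite [leRHS]big_nat_recr//= lerDl.
    exact: le_trans (mono _) (le_trans (mono _) (mono _)).
  by rewrite hN gerBl invr_ge0.
rewrite (muE cmu mX) (mass_LambdaP cmu) lee_fin; lra.
Qed.

(** The distortion accumulated over n digits: E(n+1)/E(n) = exp(2^-n), which dominates 1 + 2^-n, and
    E stays below e^2. *)
Let E (n : nat) : R := expR (2 - 2 / 2 ^+ n).

Let E_step n : (1 + (2 ^+ n)^-1) * E n <= E n.+1.
Proof.
have -> : E n.+1 = expR ((2 ^+ n)^-1) * E n.
  by rewrite /E -expRD; congr expR; rewrite exprS; field; rewrite expf_neq0.
by rewrite ler_pM2r ?expR_gt0// expR_ge1Dx.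
Qed.

Let cyl_point w (B : set R) x : all prime w -> cyl w B x -> exists2 y, 0 < y < 1 &
  x = num w y / den w y.
Proof.
move=> pw [Xx [px _]]; exists (iter (size w) T x).
  by have [] := LambdaP_iter (size w) Xx.
by rewrite {1}(LambdaP_mobius (size w) Xx) px.
Qed.

(** Induction by prepending a digit a. The cylinder lies within t = 2^-|w| of x0 = phi_w(0), so on
    it a + x is a + x0 up to a factor 1 + t, and (a + x0) q_w is the continuant of a::w. *)
Lemma cyl_bounds_aux w (B : set R) : measurable B -> all prime w ->
  (qden R w * E (size w)) `^ (- (2 * delta)) * mass (X `&` B) <= mass (cyl w B) /\
  mass (cyl w B) <= (qden R w / E (size w)) `^ (- (2 * delta)) * mass (X `&` B).
Proof.
move=> mB; have d0 := ltW (lt_trans ltr01 delta_gt_half).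
elim: w => [_|a w IH /= /andP[pa pw]].
  have E0 : E 0 = 1 by rewrite /E expr0 divr1 subrr expR0.
  have D0 : qden R [::] = 1 by [].
  by rewrite cyl_nil /= E0 D0 mulr1 divr1 powR1 mul1r.
have [IHl IHu] := IH pw.
have mc : measurable (cyl w B) by exact: measurable_cyl.
have cX : cyl w B `<=` X by move=> x [].
have [Dn0 DE] := qden_cons R a pw.
have D1 := qden_ge1 R pw.
set x0 := num w 0 / qden R w in DE.
have [nn _ _ _ _] := cnd_bounds pw (lexx (0 : R)).
have x00 : 0 <= x0 by rewrite divr_ge0// (le_trans ler01).
have a2 : 2 <= a%:R :> R by rewrite ler_nat prime_gt1.
set t : R := (2 ^+ size w)^-1.
have p2 : 1 <= 2 ^+ size w :> R by rewrite exprn_ege1// ler1n.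
have t0 : 0 < t by rewrite invr_gt0 (lt_le_trans ltr01).
have En0 n : 0 < E n by exact: expR_gt0.
have close x : cyl w B x -> `|x - x0| <= t /\ 0 <= x.
  move=> cx; have [y /andP[y0 y1] ->] := cyl_point pw cx; split; last first.
    have [h1 h2 h3 h4 _] := cnd_bounds pw (ltW y0).
    by rewrite divr_ge0//; lra.
  apply: (le_trans (mobius_dist_le pw (ltW y0) (lexx 0))).
  rewrite subr0 gtr0_norm// ler_pdivrMr; last by rewrite exprn_gt0; lra.
  have hD := qden_size R pw.
  have h : 1 <= t * qden R w by rewrite /t mulrC ler_pdivlMr ?mul1r//; lra.
  rewrite expr2 mulrA; nra.
have -> : cyl (a :: w) B = branch a (cyl w B) by rewrite cyl_cons.
split.
- apply: (@le_trans _ _ (((a%:R + x0) * (1 + t)) `^ (- (2 * delta)) *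
      mass (cyl w B))); last first.
    apply: (mass_branch_ge cmu) => //; first exact: powR_ge0.
    move=> x /close[]; rewrite ler_norml => /andP[_ h] h0.
    by apply: powR_antimono => //; nra.
  apply: (le_trans _ (ler_wpM2l (powR_ge0 _ _) IHl)).
  rewrite mulrA ler_wpM2r ?mass_ge0// -powRM; [|nra|by rewrite mulr_ge0 ?ltW//; lra].
  apply: powR_antimono => //.
    by rewrite !mulr_gt0//; lra.
  rewrite DE.
  have -> : (a%:R + x0) * (1 + t) * (qden R w * E (size w)) =
    ((a%:R + x0) * qden R w) * ((1 + t) * E (size w)) by ring.
  by apply: ler_wpM2l; [rewrite mulr_ge0//; lra|exact: E_step].
- apply: (@le_trans _ _ (((a%:R + x0) / (1 + t)) `^ (- (2 * delta)) *
      mass (cyl w B))).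
    apply: (mass_branch_le cmu) => //.
    move=> x /close[]; rewrite ler_norml => /andP[h _] h0.
    apply: powR_antimono => //; first by rewrite divr_gt0//; lra.
    rewrite ler_pdivrMr; nra.
  apply: (le_trans (ler_wpM2l (powR_ge0 _ _) IHu)).
  rewrite mulrA ler_wpM2r ?mass_ge0// -powRM; [|by rewrite divr_ge0//; lra|by rewrite divr_ge0 ?ltW//; lra].
  apply: powR_antimono => //.
    by rewrite divr_gt0// DE mulr_gt0//; lra.
  rewrite DE.
  have -> : (a%:R + x0) / (1 + t) * (qden R w / E (size w)) =
    ((a%:R + x0) * qden R w) / ((1 + t) * E (size w)).
    by field; rewrite !gt_eqF//; lra.
  rewrite ler_wpM2l//; first by rewrite mulr_ge0//; lra.
  by rewrite lef_pV2 ?posrE ?E_step// mulr_gt0//; lra.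
Qed.

Definition distortion : R := expR 2 `^ (2 * delta).

Lemma distortion_gt0 : 0 < distortion.
Proof. by rewrite powR_gt0// expR_gt0. Qed.

Let E_le n : E n <= expR 2.
Proof. by rewrite ler_expR gerBl divr_ge0// exprn_ge0. Qed.

Lemma mass_cyl_le w (B : set R) : measurable B -> all prime w ->
  mass (cyl w B) <= distortion * qden R w `^ (- (2 * delta)) * mass (X `&` B).
Proof.
move=> mB pw; have [_ h] := cyl_bounds_aux mB pw.
apply: (le_trans h); rewrite ler_wpM2r ?mass_ge0//.
have d0 := ltW (lt_trans ltr01 delta_gt_half).
have D1 := qden_ge1 R pw.
have e2 : 0 < expR 2 :> R by exact: expR_gt0.
apply: (@le_trans _ _ ((qden R w / expR 2) `^ (- (2 * delta)))).
  apply: powR_antimono => //; first by rewrite divr_gt0//; lra.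
  by rewrite ler_wpM2l ?lef_pV2 ?posrE ?expR_gt0// ?E_le; lra.
rewrite powRM ?invr_ge0//; last lra.
rewrite mulrC /distortion ler_wpM2r ?powR_ge0//.
by rewrite -[(expR 2)^-1]powR_inv1 ?expR_ge0// -powRrM mulN1r opprK.
Qed.

Lemma mass_cyl_ge w (B : set R) : measurable B -> all prime w ->
  distortion^-1 * qden R w `^ (- (2 * delta)) * mass (X `&` B) <= mass (cyl w B).
Proof.
move=> mB pw; have [h _] := cyl_bounds_aux mB pw.
apply: (le_trans _ h); rewrite ler_wpM2r ?mass_ge0//.
have d0 := ltW (lt_trans ltr01 delta_gt_half).
have D1 := qden_ge1 R pw.
have e2 : 0 < expR 2 :> R by exact: expR_gt0.
apply: (@le_trans _ _ ((qden R w * expR 2) `^ (- (2 * delta)))); last first.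
  apply: powR_antimono => //; first by rewrite mulr_gt0 ?expR_gt0//; lra.
  by rewrite ler_wpM2l ?E_le; lra.
rewrite powRM ?(ltW e2)//; last lra.
by rewrite mulrC /distortion -powRN.
Qed.

(** Quasi-independence of past and future: the continuant is eliminated by comparing with the full
    cylinder, which costs the distortion twice. *)
Lemma mass_cyl_quasi_le w (B : set R) : measurable B -> all prime w ->
  mass (cyl w B) <= distortion ^+ 2 * mass (X `&` B) * mass (cyl w setT).
Proof.
move=> mB pw; apply: (le_trans (mass_cyl_le mB pw)).
have := mass_cyl_ge measurableT pw; rewrite setIT (mass_LambdaP cmu) mulr1.
have k0 := distortion_gt0; have m0 := mass_ge0 mu (X `&` B).
rewrite ler_pdivrMl// => h.
have -> : distortion ^+ 2 * mass (X `&` B) * mass (cyl w setT) =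
  distortion * (distortion * mass (cyl w setT)) * mass (X `&` B) by ring.
by rewrite ler_wpM2r// ler_wpM2l// ltW.
Qed.

Lemma mass_cyl_quasi_ge w (B : set R) : measurable B -> all prime w ->
  distortion ^- 2 * mass (X `&` B) * mass (cyl w setT) <= mass (cyl w B).
Proof.
move=> mB pw; apply: (le_trans _ (mass_cyl_ge mB pw)).
have := mass_cyl_le measurableT pw; rewrite setIT (mass_LambdaP cmu) mulr1.
have k0 := distortion_gt0; have m0 := mass_ge0 mu (X `&` B).
set p := _ `^ _ => h.
have -> : distortion ^- 2 * mass (X `&` B) * mass (cyl w setT) =
  distortion^-1 * mass (X `&` B) * (mass (cyl w setT) / distortion).
  by field; rewrite gt_eqF.
rewrite [leRHS]mulrAC ler_wpM2l//; first by rewrite mulr_ge0// invr_ge0 ltW.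
by rewrite ler_pdivrMr// mulrC.
Qed.

(** An inequality between masses on all cylinders of length n adds up over the partition of X into
    them. *)
Lemma mass_partition n (A B : set R) c : measurable A -> measurable B -> 0 <= c ->
  (forall w, size w = n -> all prime w ->
    mass (A `&` cyl w setT) <= c * mass (B `&` cyl w setT)) ->
  mass (A `&` X) <= c * mass (B `&` X).
Proof.
(* Words are coded by naturals, turning the partition into a sequence of sets, empty at
   non-codes. *)
move=> mA mB c0 h; pose C k := [set x | X x /\ pickle (pref n x) = k].
have CE k : C k = set0 \/ exists w, [/\ size w = n, all prime w & C k = cyl w setT].
  have [->|/set0P[x [Xx xk]]] := eqVneq (C k) set0; first by left.
  right; exists (pref n x); rewrite size_pref prime_pref//; split=> //.
  apply/seteqP; split=> y; rewrite /cyl/= ?size_pref.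
    by move=> [Xy]; rewrite -xk => /(pcan_inj pickleK).
  by move=> [Xy [yx _]]; split=> //; rewrite yx.
have mC k : measurable (C k).
  by have [->//|[w [_ _ ->]]] := CE k; exact: measurable_cyl.
have muC A' : measurable A' -> mu (A' `&` X) = (\sum_(k <oo) mu (A' `&` C k))%E.
  move=> mA'; have -> : A' `&` X = \bigcup_k (A' `&` C k).
    apply/seteqP; split=> x.
      by move=> [Ax Xx]; exists (pickle (pref n x)).
    by move=> [k _ [Ax [Xx _]]].
  rewrite measure_bigcup//; first by apply: eq_eseriesl => i; rewrite in_setT.
    by move=> k _; exact: measurableI.
  by move=> i j _ _ [x [[_ [_ <-]] [_ [_ <-]]]].
rewrite -lee_fin EFinM -!(muE cmu); try (by apply: measurableI => //; exact: mX).
rewrite !muC// -nneseriesZl//; apply: lee_nneseries => // k _.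
have mI A' : measurable A' -> measurable (A' `&` C k) by move=> ?; exact: measurableI.
rewrite !(muE cmu)//; try exact: mI.
rewrite -EFinM lee_fin.
have [->|[w [sw pw ->]]] := CE k; last exact: h.
by rewrite !setI0 mass0 mulr0.
Qed.

End Distortion.

(** * Polynomial growth of the digits almost everywhere *)

Section Tail.
Variables (R : realType) (delta : R) (mu : {measure set R -> \bar R}).
Hypothesis cmu : conformal delta mu.
Local Notation X := (@LambdaP R).
Local Notation T := (@gauss R).
Local Notation digit := (@cf_entry R).
Local Notation mass := (mass mu).
Local Notation mX := (@measurable_LambdaP R).

Lemma measurable_digit n (P : nat -> Prop) :
  measurable [set x | X x /\ P (digit x n)].
Proof.
elim: n => [|n IH].
  have -> : [set x | X x /\ P (digit x 0)] =
      \bigcup_(p in P) branch p X.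
    apply/seteqP; split=> x.
      move=> [Xx Px]; exists (digit x 0) => //.
      by have [_ _ XT _] := LambdaP_gauss Xx.
    by move=> [p Pp [Xx [dx _]]]; split=> //; rewrite dx.
  by apply: bigcup_measurable => p _; apply: measurable_branch; exact: mX.
have -> : [set x | X x /\ P (digit x n.+1)] =
    \bigcup_(p in setT) branch p [set x | X x /\ P (digit x n)].
  apply/seteqP; split=> x.
    move=> [Xx Px]; exists (digit x 0) => //.
    by have [_ _ XT _] := LambdaP_gauss Xx; split=> //; split=> //; split=> //; rewrite -cf_entryS.
  by move=> [p _ [Xx [dx [_ +]]]]; rewrite -cf_entryS.
by apply: bigcup_measurable => p _; exact: measurable_branch.
Qed.

Lemma mass_digit_shift n (P : nat -> Prop) :
  mass [set x | X x /\ P (digit x n)] <=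
  distortion delta ^+ 2 * mass [set x | X x /\ P (digit x 0)].
Proof.
set A := [set x | X x /\ P (digit x n)]; set B := [set x | X x /\ P (digit x 0)].
have mA : measurable A by exact: measurable_digit.
have mB : measurable B by exact: measurable_digit.
have := @mass_partition _ _ _ cmu n A setT (distortion delta ^+ 2 * mass B) mA measurableT.
rewrite setTI (mass_LambdaP cmu) mulr1 (_ : A `&` X = A); last first.
  by apply/seteqP; split=> [x []|x [Xx ?]].
apply; first by rewrite mulr_ge0 ?mass_ge0// exprn_ge0// ltW// distortion_gt0.
move=> w sw pw; rewrite setTI.
have -> : A `&` cyl w setT = cyl w B.
  apply/seteqP; split=> x; rewrite /cyl/= sw.
    move=> [[Xx Px] [_ [h _]]]; split=> //; split=> //; split; last exact: Px.
    exact: LambdaP_iter.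
  by move=> [Xx [h [_ Px]]]; split.
rewrite -[B in leRHS](setIidr (_ : B `<=` X)); last by move=> x [].
exact: (mass_cyl_quasi_le cmu).
Qed.

(** The ratio of the dyadic tail: at most 2^k digits lie in [2^k, 2^(k+1)), each of mass at most
    2^(-2 delta k). It is below 1 because 2 delta > 1. *)
Let theta : R := 2 `^ (1 - 2 * delta).

Let theta01 : 0 < theta < 1.
Proof.
rewrite /theta powR_gt0//= -opprB powRN invf_lt1 ?powR_gt0//.
have d0 : 0 < 2 * delta - 1 by rewrite subr_gt0 (delta_gt_half cmu).
have : 1 `^ (2 * delta - 1) < 2 `^ (2 * delta - 1) :> R.
  by apply: gt0_ltr_powR; rewrite ?nnegrE// ltr1n.
by rewrite powR1.
Qed.

Let dyadic k : set R := [set x | X x /\ (2 ^ k <= digit x 0 < 2 ^ k.+1)%N].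

Let mass_dyadic k : mass (dyadic k) <= theta ^+ k.
Proof.
have mD : measurable (dyadic k) by exact: (@measurable_digit 0 (fun d => 2 ^ k <= d < 2 ^ k.+1)%N).
pose s := iota (2 ^ k) (2 ^ k).
apply: (le_trans (@mass_le_sum_branch _ _ _ cmu s _ mD _ _)); first by move=> x [].
  move=> x [_ h]; rewrite mem_iota; move: h; rewrite expnS; lia.
apply: (@le_trans _ _ (\sum_(p <- s) (2 ^+ k) `^ (- (2 * delta)))).
  rewrite !big_seq; apply: ler_sum => p; rewrite mem_iota => /andP[kp _].
  have d0 := delta_gt_half cmu.
  have [pp|/branch_not_prime->] := boolP (prime p); last first.
    by rewrite mass0 powR_ge0.
  apply: (le_trans (mass_branchX_le cmu pp)).
  apply: powR_antimono; [lra|by rewrite exprn_gt0|].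
  by rewrite -natrX ler_nat.
rewrite big_const_seq count_predT size_iota iter_addr_0 -[leLHS]mulr_natl natrX.
have n2 : (2 : R) != 0 by rewrite pnatr_eq0.
rewrite -!powR_mulrn ?powR_ge0// /theta -!powRrM -powRD ?n2 ?implybT//.
by rewrite le_eqVlt; apply/orP; left; apply/eqP; congr (_ `^ _); ring.
Qed.

Let mass_digit_ge k :
  mass [set x | X x /\ (2 ^ k <= digit x 0)%N] <= theta ^+ k / (1 - theta).
Proof.
have /andP[t0 t1] := theta01.
have mA : measurable [set x | X x /\ (2 ^ k <= digit x 0)%N].
  exact: (@measurable_digit 0 (fun d => (2 ^ k <= d)%N)).
have mD j : measurable (dyadic j).
  exact: (@measurable_digit 0 (fun d => 2 ^ j <= d < 2 ^ j.+1)%N).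
rewrite -lee_fin -(muE cmu)//.
apply: (@le_trans _ _ (\sum_(j <oo) mu (dyadic (k + j)))%E).
  apply: measure_sigma_subadditive => // x [Xx kx].
  set t := trunc_log 2 (digit x 0).
  have d0 : (0 < digit x 0)%N by rewrite (leq_trans _ kx)// expn_gt0.
  have /andP[h1 h2] := trunc_log_bounds (isT : (1 < 2)%N) d0.
  have kt : (k <= t)%N by rewrite -ltnS -(ltn_exp2l _ _ (isT : (1 < 2)%N)) (leq_ltn_trans kx).
  by exists (t - k)%N => //; rewrite /dyadic/= subnKC//; split=> //; rewrite h1.
apply: nneseries_le_cst => // N.
apply: (@le_trans _ _ (\sum_(0 <= j < N) (theta ^+ (k + j))%:E)%E).
  by apply: lee_sum => j _; rewrite (muE cmu)// lee_fin.
rewrite sumEFin lee_fin.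
have -> : \sum_(0 <= j < N) theta ^+ (k + j) = theta ^+ k / (1 - theta) * (1 - theta ^+ N).
  elim: N => [|N IH]; first by rewrite big_geq// expr0 subrr mulr0.
  by rewrite big_nat_recr//= IH exprD exprS; field; rewrite subr_eq0 gt_eqF.
rewrite ler_piMr//; first by rewrite divr_ge0 ?exprn_ge0 ?ltW// subr_gt0.
by rewrite gerBl exprn_ge0// ltW.
Qed.

Let sum_inv_square N : \sum_(0 <= n < N) 4 / (n.+1%:R ^+ 2) <= 8 :> R.
Proof.
suff : \sum_(0 <= n < N) 4 / (n.+1%:R ^+ 2) <= 8 - 8 / N.+1%:R :> R.
  by move/le_trans; apply; rewrite gerBl divr_ge0.
elim: N => [|N IH]; first by rewrite big_geq// divr1 subrr.
rewrite big_nat_recr//=; apply: (le_trans (lerD IH (lexx _))).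
rewrite -[N.+2%:R]natr1; set n : R := N.+1%:R.
have n1 : 1 <= n by rewrite ler1n.
rewrite -subr_ge0.
have -> : 8 - 8 / (n + 1) - (8 - 8 / n + 4 / n ^+ 2) = 4 * (n - 1) / (n ^+ 2 * (n + 1)).
  by field; rewrite !gt_eqF//; lra.
by rewrite divr_ge0// mulr_ge0 ?exprn_ge0//; lra.
Qed.

(** Borel-Cantelli for the events that the n-th digit is at least 2^(C t), where 2^t is the largest
    power of 2 not above n + 1. *)
Lemma digit_growth : exists (C : nat) (N : set R), [/\ measurable N, mu N = 0%E &
  forall x, X x -> ~ N x -> exists n0, forall n, (n0 <= n)%N ->
    (digit x n <= n.+1 ^ C)%N].
Proof.
have /andP[t0 t1] := theta01.
(* With theta^C <= 1/4 the n-th event has mass of order 4^-t, at most a constant times (n+1)^-2,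
   which is summable. *)
have [C hC] : exists C : nat, theta ^+ C <= 4^-1.
  have : theta ^+ n @[n --> \oo] --> 0 by apply: cvg_expr; rewrite gtr0_norm.
  move=> /cvgr0Pnorm_le /(_ 4^-1) []; first by rewrite invr_gt0.
  move=> C _ /(_ C (leqnn C)) /=; rewrite ger0_norm; last by rewrite exprn_ge0// ltW.
  by move=> h; exists C.
pose t n := trunc_log 2 n.+1.
have tP n : (2 ^ t n <= n.+1 < 2 ^ (t n).+1)%N by exact: trunc_log_bounds.
pose W n : set R := [set x | X x /\ (2 ^ (C * t n) <= digit x n)%N].
have mW n : measurable (W n).
  exact: (@measurable_digit n (fun d => (2 ^ (C * t n) <= d)%N)).
pose K := distortion delta ^+ 2 / (1 - theta).
have K0 : 0 <= K.
  by rewrite divr_ge0 ?subr_ge0 ?(ltW t1)// exprn_ge0// ltW// distortion_gt0.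
have hW n : mass (W n) <= K * (4 / (n.+1%:R ^+ 2)).
  apply: (le_trans (@mass_digit_shift n (fun d => (2 ^ (C * t n) <= d)%N))).
  apply: (le_trans (ler_wpM2l _ (mass_digit_ge _))).
    by rewrite exprn_ge0// ltW// distortion_gt0.
  rewrite [_ / (1 - theta)]mulrC mulrA -/K ler_wpM2l//.
  have /andP[_ h] := tP n.
  have h2 : n.+1%:R <= 2 * 2 ^+ t n :> R.
    by rewrite -exprS -natrX ler_nat ltnW.
  apply: (@le_trans _ _ ((4^-1) ^+ t n)).
    by rewrite exprM lerXn2r ?nnegrE ?invr_ge0// exprn_ge0// ltW.
  have -> : (4^-1) ^+ t n = (2 ^+ t n) ^- 2 :> R.
    by rewrite exprVn; congr (_^-1); rewrite -!natrX -expnM mulnC expnM.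
  have p0 : 0 < 2 ^+ t n :> R by rewrite exprn_gt0.
  rewrite ler_pdivlMr ?exprn_gt0// -ler_pdivlMl ?invr_gt0 ?exprn_gt0// invrK.
  have := ltr0Sn R n; rewrite !expr2; nra.
exists C, (lim_sup_set W); split.
- by apply: bigcap_measurable => // k _; exact: bigcup_measurable.
- apply: lim_sup_set_cvg0 => //.
  apply: (@le_lt_trans _ _ (K * 8)%:E); last exact: ltry.
  apply: nneseries_le_cst => // m.
  apply: (@le_trans _ _ (\sum_(0 <= n < m) (K * (4 / (n.+1%:R ^+ 2)))%:E)%E).
    by apply: lee_sum => j _; rewrite (muE cmu)// lee_fin.
  by rewrite sumEFin lee_fin -mulr_sumr ler_wpM2l.
move=> x Xx nW; have [m hm] : exists m, forall n, (m <= n)%N -> ~ W n x.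
  apply: contrapT => /forallNP h; apply: nW => m _.
  by have /existsNP[n /not_implyP[mn /contrapT Wn]] := h m; exists n.
exists m => n mn; have := hm n mn; rewrite /W /= => /not_andP[//|/negP].
rewrite -ltnNge => /ltnW h; apply: (leq_trans h).
case: (C) => // C'; rewrite mulnC expnM leq_exp2r//; by case/andP: (tP n).
Qed.

End Tail.

(** * Prime gaps: a global bound and isolated primes *)

Section Primes.
Variable R : realType.

Lemma next_primeP m : [/\ (m < next_prime m)%N, prime (next_prime m) &
  forall q, (m < q)%N -> prime q -> (next_prime m <= q)%N].
Proof.
rewrite /next_prime; case: ex_minnP => q /andP[mq pq] qmin; split=> // r mr pr.
by apply: qmin; rewrite mr.
Qed.

Lemma prime_nth_prime n : prime (nth_prime n).
Proof. by case: n => //= n; have [] := next_primeP (nth_prime n). Qed.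

Lemma nth_prime_lt n : (nth_prime n < nth_prime n.+1)%N.
Proof. by have [] := next_primeP (nth_prime n). Qed.

Lemma nth_prime_gap n : nth_prime n.+1 = (nth_prime n + gap n)%N.
Proof. by rewrite /gap subnKC// ltnW// nth_prime_lt. Qed.

Lemma nth_prime_mono : {mono nth_prime : m n / (m <= n)%N}.
Proof. exact: (leq_mono (homo_ltn ltn_trans nth_prime_lt)). Qed.

Lemma nth_prime_ge n : (n.+2 <= nth_prime n)%N.
Proof. by elim: n => // n IH; rewrite (leq_ltn_trans IH)// nth_prime_lt. Qed.

Lemma nth_prime_surj p : prime p -> exists n, nth_prime n = p.
Proof.
move=> pp; have ex : exists n, (p <= nth_prime n)%N.
  by exists p; rewrite (leq_trans _ (nth_prime_ge p))// leqW.
case: (ex_minnP ex) => -[|n] pn nmin; [exists 0%N|exists n.+1]; apply/eqP.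
  by rewrite eqn_leq pn andbT prime_gt1.
rewrite eqn_leq pn andbT; have [_ _ h] := next_primeP (nth_prime n).
by apply: h => //; rewrite ltnNge; apply/negP => /nmin; rewrite ltnn.
Qed.

Let lnp n : ln 2 <= ln (nth_prime n)%:R :> R.
Proof. by rewrite ler_ln ?posrE ?ltr0n ?ler_nat ?prime_gt1 ?prime_gt0 ?prime_nth_prime. Qed.

Let ln2 : 0 < ln 2 :> R.
Proof. by rewrite ln_gt0 ?ltr1n. Qed.

Lemma limn_esup_ltP (u : nat -> \bar R) : (limn_esup u < +oo)%E ->
  exists M N, forall n, (N <= n)%N -> (u n <= M%:E)%E.
Proof.
move=> /ereal_inf_lt[_ [V [N _ NV] <-] Voo].
have [M hM] : exists M : R, (ereal_sup [set u x | x in V] <= M%:E)%E.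
  case: (ereal_sup _) Voo => [r _|//|_]; first by exists r.
  by exists 0; rewrite leNye.
exists M, N => n Nn; apply: le_trans hM; apply: ereal_sup_ubound.
by exists n => //; exact: NV.
Qed.

Lemma limn_esup_gtP (u : nat -> \bar R) : (0 < limn_esup u)%E ->
  exists2 c : R, 0 < c & forall N, exists2 n, (N <= n)%N & (c%:E < u n)%E.
Proof.
move=> h; have [c c0 hc] : exists2 c : R, 0 < c & (c%:E < limn_esup u)%E.
  move: h; case: (limn_esup u) => [r|_|//].
    by rewrite lte_fin => r0; exists (r / 2); rewrite ?lte_fin; lra.
  by exists 1 => //; rewrite ltry.
exists c => // N.
have : (c%:E < ereal_sup [set u x | x in [set n | (N <= n)%N]])%E.
  apply: (lt_le_trans hc); apply: ereal_inf_lbound.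
  by exists [set n | (N <= n)%N] => //; exists N.
by move=> /ereal_sup_gt[_ [n Nn <-] cn]; exists n.
Qed.

Lemma mingap1 n : mingap 1 n = gap n.+1.
Proof. by rewrite /mingap big_ltn// big_geq// addn1 minnn. Qed.

Lemma mingap2 n : mingap 2 n = minn (gap n.+1) (gap n.+2).
Proof.
rewrite /mingap big_ltn// big_ltn// big_geq// addn1 addn2.
by rewrite [minn (gap n.+2) _]minnC minnA minnn.
Qed.

(** Finiteness of R_1 bounds all gaps from some index on; the finitely many earlier ones are
    absorbed into the constant through their sum. *)
Lemma gap_bound : (Rk R 1 < +oo)%E ->
  exists2 K : R, 0 < K & forall n, (gap n)%:R <= K * ln (nth_prime n)%:R ^+ 2.
Proof.
move=> /limn_esup_ltP[M [N hN]].
pose G : R := (\sum_(i < N.+1) gap i)%:R / ln 2 ^+ 2.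
have G0 : 0 <= G by rewrite divr_ge0// exprn_ge0// ltW.
exists (`|M| + G + 1); first by rewrite ltr_pwDr// addr_ge0.
move=> n; have l2 : 0 < ln (nth_prime n)%:R ^+ 2 :> R.
  by rewrite exprn_gt0// (lt_le_trans ln2).
have [nN|] := leqP n N.
  apply: (@le_trans _ _ (G * ln (nth_prime n)%:R ^+ 2)).
    rewrite /G mulrAC ler_pdivlMr ?exprn_gt0// ler_pM ?exprn_ge0 ?(ltW ln2)//.
      by rewrite ler_nat (bigD1 (Ordinal (nN : (n < N.+1)%N)))//= leq_addr.
    by rewrite lerXn2r ?nnegrE ?(ltW ln2)// (le_trans (ltW ln2)).
  by rewrite ler_wpM2r ?(ltW l2)// -addrA addrCA lerDl addr_ge0.
case: n l2 => // n l2; rewrite ltnS => /hN; rewrite mingap1 lee_fin.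
have l3 : 0 < ln (nth_prime n)%:R ^+ 2 :> R.
  by rewrite exprn_gt0// (lt_le_trans ln2).
rewrite ler_pdivrMr// => /le_trans; apply.
apply: (@le_trans _ _ (`|M| * ln (nth_prime n)%:R ^+ 2)).
  by rewrite ler_wpM2r ?(ltW l3)// ler_norm.
apply: (@le_trans _ _ (`|M| * ln (nth_prime n.+1)%:R ^+ 2)); last first.
  by rewrite ler_wpM2r ?(ltW l2)// -addrA lerDl addr_ge0.
rewrite ler_wpM2l// lerXn2r ?nnegrE ?(le_trans (ltW ln2))//.
by rewrite ler_ln ?posrE ?ltr0n ?prime_gt0 ?prime_nth_prime// ler_nat ltnW ?nth_prime_lt.
Qed.

(** Starting at m, consecutive primes below 2m are at most g = K ln(2m)^2 apart, so floor(k/g) steps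
    stay within [m, m+k]. *)
Lemma prime_count (K : R) m (k : R) :
  (forall n, (gap n)%:R <= K * ln (nth_prime n)%:R ^+ 2) -> 0 < K ->
  prime m -> 0 <= k <= m%:R -> exists s : seq nat,
  [/\ uniq s, all prime s, (forall q, q \in s -> (m%:R : R) <= q%:R <= m%:R + k),
   (1 <= size s)%N & k + 1 <= (size s)%:R * (1 + K * ln (2 * m%:R) ^+ 2)].
Proof.
move=> hK K0 pm /andP[k0 km]; have [i im] := nth_prime_surj pm.
have m2 : 2 <= m%:R :> R by rewrite ler_nat prime_gt1.
pose g := K * ln (2 * m%:R) ^+ 2.
have lnm : 0 < ln (2 * m%:R) :> R by rewrite ln_gt0//; lra.
have g0 : 0 < g by rewrite mulr_gt0// exprn_gt0.
have step j : j%:R * g <= k -> (nth_prime (i + j))%:R <= m%:R + j%:R * g.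
  elim: j => [|j IH hj]; first by rewrite addn0 im mul0r addr0.
  have hj' : j%:R * g <= k.
    by apply: le_trans hj; rewrite ler_wpM2r ?(ltW g0)// ler_nat.
  have {}IH := IH hj'; rewrite addnS nth_prime_gap natrD.
  have : (gap (i + j))%:R <= g.
    apply: (le_trans (hK _)); rewrite ler_wpM2l ?(ltW K0)//.
    rewrite lerXn2r ?nnegrE ?(ltW lnm) ?(le_trans (ltW ln2))//.
    rewrite ler_ln ?posrE ?ltr0n ?prime_gt0 ?prime_nth_prime//; lra.
  by move=> h; rewrite -natr1 mulrDl mul1r; lra.
pose J := Num.truncn (k / g).
have kg0 : 0 <= k / g by rewrite divr_ge0// ltW.
have /andP[J1 J2] := truncn_itv kg0.
exists [seq nth_prime (i + j) | j <- iota 0 J.+1]; split.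
- rewrite map_inj_uniq ?iota_uniq// => a b.
  have inj : injective nth_prime by exact: (incn_inj nth_prime_mono).
  by move/inj/addnI.
- by apply/allP => _ /mapP[j _ ->]; exact: prime_nth_prime.
- move=> q /mapP[j]; rewrite mem_iota add0n => /andP[_ jJ] ->.
  have jk : j%:R * g <= k.
    by rewrite -ler_pdivlMr// (le_trans _ J1)// ler_nat -ltnS.
  rewrite (le_trans (step _ jk)) ?lerD2l// andbT -im ler_nat nth_prime_mono.
  exact: leq_addr.
- by rewrite size_map size_iota.
- rewrite size_map size_iota -/g mulrDr mulr1 addrC lerD ?ler1n//.
  by rewrite -ler_pdivrMr// ltW.
Qed.

(** R_2 > 0 makes two consecutive gaps large infinitely often; the prime between them is far from
    both neighbours. *)
Lemma isolated_primes : (Rk R 1 < +oo)%E -> (0 < Rk R 2)%E ->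
  exists2 c : R, 0 < c & forall M, exists p g : nat,
   [/\ prime p, (M <= p)%N, (2 <= g <= p)%N, c * ln p%:R ^+ 2 <= g%:R &
    forall q, prime q -> q != p -> (q + g <= p)%N || (p + g <= q)%N].
Proof.
move=> /gap_bound[K K0 hK] /limn_esup_gtP[c c0 hc].
(* By [gap_bound] the next prime is at most (1 + K) p^2, so ln grows by at most a factor C from one
   prime to the next. Passing from ln p_n to ln p_(n+2), squared, costs C^4. *)
have lnS n : ln (nth_prime n.+1)%:R <= (ln (1 + K) / ln 2 + 2) * ln (nth_prime n)%:R.
  set x : R := (nth_prime n)%:R.
  have x2 : 2 <= x by rewrite ler_nat prime_gt1// prime_nth_prime.
  have lx : 0 <= ln x by rewrite ln_ge0//; lra.
  have lxx : ln x <= x.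
    by have := @ln_sublinear R x; rewrite (lt_le_trans _ x2)// => /(_ isT)/ltW.
  have h : (nth_prime n.+1)%:R <= (1 + K) * x ^+ 2.
    rewrite nth_prime_gap natrD -/x; have := hK n; rewrite -/x => h.
    have : K * ln x ^+ 2 <= K * x ^+ 2.
      by rewrite ler_wpM2l ?(ltW K0)// lerXn2r ?nnegrE//; lra.
    rewrite !expr2; nra.
  have p0 : 0 < (nth_prime n.+1)%:R :> R by rewrite ltr0n prime_gt0// prime_nth_prime.
  apply: (@le_trans _ _ (ln ((1 + K) * x ^+ 2))).
    by rewrite ler_ln ?posrE// (lt_le_trans p0).
  rewrite lnM ?posrE ?exprn_gt0//; try lra.
  rewrite lnXn; last lra.
  rewrite mulrDl [2 * _]mulr_natl lerD2r mulrAC -mulrA ler_peMr//.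
    by rewrite ln_ge0; lra.
  by rewrite ler_pdivlMr// mul1r lnp.
set C := _ + 2 in lnS.
have C0 : 0 < C.
  have : 0 <= ln (1 + K) / ln 2 by rewrite divr_ge0 ?(ltW ln2)// ln_ge0; lra.
  by rewrite /C; lra.
exists (c / C ^+ 4); first by rewrite divr_gt0// exprn_gt0.
move=> M; have [n Mn hn] := hc M.
have pp := prime_nth_prime n.+2.
have p1 := nth_prime_lt n.+1; have p2 := nth_prime_lt n.+2.
have g1 := nth_prime_gap n.+1; have g2 := nth_prime_gap n.+2.
have oddp k : odd (nth_prime k.+1).
  have [h|//] := even_prime (prime_nth_prime k.+1).
  by have := nth_prime_ge k.+1; rewrite h.
have gap2 k : (2 <= gap k.+1)%N.
  have := oddp k.+1; rewrite nth_prime_gap oddD oddp /= => og.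
  have := nth_prime_lt k.+1; rewrite (nth_prime_gap k.+1).
  by case: (gap k.+1) og => [|[|]] //; rewrite addn0 ltnn.
have [gl gr] : (mingap 2 n <= gap n.+1)%N /\ (mingap 2 n <= gap n.+2)%N.
  by rewrite mingap2 geq_minl geq_minr.
exists (nth_prime n.+2), (mingap 2 n); split=> //.
- by rewrite (leq_trans Mn)// (leq_trans _ (nth_prime_ge _))// !leqW.
- apply/andP; split; first by rewrite mingap2 leq_min !gap2.
  by rewrite g1 (leq_trans gl)// leq_addl.
- have l0 : 0 < ln (nth_prime n)%:R ^+ 2 :> R by rewrite exprn_gt0// (lt_le_trans ln2).
  move: hn; rewrite lte_fin ltr_pdivlMr// => /ltW; apply: le_trans.
  rewrite mulrAC ler_pdivrMr ?exprn_gt0// -mulrA ler_wpM2l ?(ltW c0)//.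
  have -> : ln (nth_prime n)%:R ^+ 2 * C ^+ 4 = (C * (C * ln (nth_prime n)%:R)) ^+ 2 by ring.
  have q0 k : 0 <= ln (nth_prime k)%:R :> R by rewrite (le_trans (ltW ln2)).
  have q1 : 0 <= C * (C * ln (nth_prime n)%:R) by rewrite !mulr_ge0 ?(ltW C0).
  rewrite lerXn2r ?nnegrE//.
  by apply: (le_trans (lnS _)); rewrite ler_wpM2l ?(ltW C0).
- move=> q /nth_prime_surj[j <-] jn.
  have [jlt|jgt|jE] := ltngtP j n.+2; last by rewrite jE eqxx in jn.
    have : (nth_prime j <= nth_prime n.+1)%N by rewrite nth_prime_mono.
    by move: gl; rewrite g1; lia.
  have : (nth_prime n.+3 <= nth_prime j)%N by rewrite nth_prime_mono.
  by move: gr; rewrite g2; lia.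
Qed.

End Primes.

(** From ln x = 2 ln(sqrt x) and ln y < y. *)
Lemma ln_sqr_le (R : realType) (x : R) : 1 <= x -> ln x ^+ 2 <= 4 * x.
Proof.
move=> x1; have x0 : 0 < x by rewrite (lt_le_trans ltr01).
have h0 : 0 < x `^ 2^-1 by rewrite powR_gt0.
have hh : x `^ 2^-1 * x `^ 2^-1 = x.
  rewrite -powRD; last by rewrite gt_eqF ?implybT.
  by rewrite (_ : 2^-1 + 2^-1 = 1) ?powRr1 ?(ltW x0)//; lra.
have h1 := @ln_sublinear R _ h0.
have h2 : ln (x `^ 2^-1) = 2^-1 * ln x by rewrite ln_powR.
have h3 : 0 <= ln x by rewrite ln_ge0.
rewrite -[in leRHS]hh expr2; nra.
Qed.

Lemma ln2_ge_half (R : realType) : 2^-1 <= ln 2 :> R.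
Proof.
rewrite -[leLHS]expRK ler_ln ?posrE ?expR_gt0// -[leLHS]invrK -expRN.
rewrite -[leRHS]invrK lef_pV2 ?posrE ?expR_gt0//.
by apply: le_trans (expR_ge1Dx _); lra.
Qed.

(** * Lower bound for the mass of renormalised balls *)

Section BallMass.
Variables (R : realType) (delta : R) (mu : {measure set R -> \bar R}) (K : R).
Hypothesis cmu : conformal delta mu.
Hypotheses (K0 : 0 < K)
  (hK : forall n, (gap n)%:R <= K * ln ((nth_prime n)%:R : R) ^+ 2).
Local Notation X := (@LambdaP R).
Local Notation T := (@gauss R).
Local Notation digit := (@cf_entry R).
Local Notation mass := (mass mu).
Local Notation mX := (@measurable_LambdaP R).

Let d0 : 0 < delta.
Proof. by have := delta_gt_half cmu; lra. Qed.

Let ln_prime p : prime p -> ln 2 <= ln p%:R :> R.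
Proof. by move=> pp; rewrite ler_ln ?posrE ?ltr0n ?ler_nat ?prime_gt1 ?prime_gt0. Qed.

Let ln2 : 0 < ln 2 :> R.
Proof. by rewrite ln_gt0 ?ltr1n. Qed.

(** From 1 + K ln(2m)^2 <= (1/ln(2)^2 + 4K) ln(m)^2, and 16 from the branch weight (4m)^(-2 delta)
    for primes up to 2m. *)
Let K1 : R := 16 * (1 / ln 2 ^+ 2 + 4 * K).

Let K1_gt0 : 0 < K1.
Proof. by rewrite /K1 mulr_gt0// addr_gt0// ?divr_gt0 ?exprn_gt0// mulr_gt0. Qed.

Lemma prime_mass m (k : R) A : prime m -> 0 <= k <= m%:R -> measurable A ->
  (forall q, prime q -> (m%:R : R) <= q%:R <= m%:R + k -> branch q X `<=` A) ->
  ((k + 1) / (K1 * (m%:R ^+ 2 * ln m%:R ^+ 2))) `^ delta <= mass A.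
Proof.
move=> pm km mA hA; have [s [us ps ms s1 sk]] := prime_count hK K0 pm km.
have /andP[k0 km'] := km.
have m2 : 2 <= m%:R :> R by rewrite ler_nat prime_gt1.
have lm := ln_prime pm.
have l2 := ln2.
apply: (le_trans _ (sum_branch_le cmu us mA (fun q qs => hA q (allP ps q qs) (ms q qs)))).
have N1 : 1 <= (size s)%:R :> R by rewrite ler1n.
set N : R := (size s)%:R in sk N1.
pose g := 1 + K * ln (2 * m%:R) ^+ 2.
have g0 : 0 < g by rewrite /g; have := mulr_ge0 (ltW K0) (sqr_ge0 (ln (2 * m%:R))); lra.
pose z := (k + 1) / g.
have z0 : 0 <= z by rewrite divr_ge0 ?(ltW g0)//; lra.
(* The number N of primes is at least max(1, z), and delta <= 1, so N >= z^delta. *)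
have zN : z `^ delta <= N.
  have [z1|/ltW z1] := leP z 1.
    apply: le_trans N1; apply: (@le_trans _ _ (1 `^ delta)); last by rewrite powR1.
    by apply: ge0_ler_powR; rewrite ?nnegrE// ltW.
  apply: (@le_trans _ _ (z `^ 1)); first by apply: ler_powR => //; exact: delta_le1 cmu.
  by rewrite powRr1// /z ler_pdivrMr.
have m0 : 0 < 16 * m%:R ^+ 2 :> R by rewrite mulr_gt0// exprn_gt0//; lra.
apply: (@le_trans _ _ (N * (16 * m%:R ^+ 2)^-1 `^ delta)); last first.
  have -> : N * (16 * m%:R ^+ 2)^-1 `^ delta = \sum_(q <- s) (16 * m%:R ^+ 2)^-1 `^ delta.
    by rewrite big_const_seq count_predT iter_addr_0 -[RHS]mulr_natl.
  rewrite !big_seq; apply: ler_sum => q qs.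
  have pq := allP ps q qs; have /andP[mq qm] := ms q qs.
  apply: (le_trans _ (mass_branchX_ge cmu pq)).
  have -> : (16 * m%:R ^+ 2)^-1 `^ delta = (4 * m%:R) `^ (- (2 * delta)).
    have -> : 16 * m%:R ^+ 2 = (4 * m%:R) `^ 2%:R :> R by rewrite powR_mulrn; [ring|lra].
    by rewrite -powRN -powRrM; congr (_ `^ _); ring.
  apply: powR_antimono; [by rewrite mulr_ge0 ?(ltW d0)|lra|].
  by move: m2 mq qm km'; lra.
apply: (@le_trans _ _ (z `^ delta * (16 * m%:R ^+ 2)^-1 `^ delta)); last first.
  by rewrite ler_wpM2r ?powR_ge0.
rewrite -powRM ?invr_ge0 ?(ltW m0)//.
have K1m : 0 < K1 * (m%:R ^+ 2 * ln m%:R ^+ 2).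
  by rewrite mulr_gt0// mulr_gt0 ?exprn_gt0//; lra.
apply: ge0_ler_powR; rewrite ?nnegrE ?(ltW d0)//.
- by rewrite divr_ge0 ?(ltW K1m)//; lra.
- by rewrite mulr_ge0// invr_ge0 ltW.
rewrite /z -mulrA -invfM ler_wpM2l//; first lra.
rewrite lef_pV2 ?posrE ?K1m ?(mulr_gt0 g0 m0)//.
have lnm2 : ln (2 * m%:R) <= 2 * ln m%:R :> R by rewrite lnM ?posrE//; lra.
have lnm0 : 0 <= ln (2 * m%:R) :> R by rewrite ln_ge0//; lra.
have h1 : 1 <= ln m%:R ^+ 2 / ln 2 ^+ 2 :> R.
  by rewrite ler_pdivlMr ?exprn_gt0// mul1r lerXn2r ?nnegrE//; lra.
have h2 : K * ln (2 * m%:R) ^+ 2 <= K * (4 * ln m%:R ^+ 2).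
  by rewrite ler_wpM2l ?(ltW K0)//; nra.
have -> : K1 * (m%:R ^+ 2 * ln m%:R ^+ 2) =
  (ln m%:R ^+ 2 / ln 2 ^+ 2 + K * (4 * ln m%:R ^+ 2)) * (16 * m%:R ^+ 2).
  by rewrite /K1; field; rewrite gt_eqF.
by rewrite ler_wpM2r ?(ltW m0)// /g lerD.
Qed.

Let K2 : R := K1 * (9 + 4 * K).

Let K2_gt0 : 0 < K2.
Proof. by rewrite mulr_gt0// addr_gt0// mulr_gt0. Qed.

(** If rho <= 1/p, the ball contains the branches of the primes in [p, p+k] with k = rho p^2 - 1. If
    rho > 1/p, it contains those of all primes in [m, 2m], where m is the least prime >= 1/rho. *)
Lemma ball_mass p y (rho : R) : prime p -> branch p X y ->
  p%:R ^- 2 <= rho <= 4 ->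
  (rho / (K2 * ln p%:R ^+ 2)) `^ delta <= mass (closed_ball y rho).
Proof.
move=> pp py /andP[rp r4].
have p2 : 2 <= p%:R :> R by rewrite ler_nat prime_gt1.
have pp0 : 0 < p%:R ^+ 2 :> R by rewrite exprn_gt0//; lra.
have r0 : 0 < rho by apply: lt_le_trans rp; rewrite invr_gt0.
have /andP[y1 y2] := branch_itv pp py.
have lp := ln_prime pp.
have l2 := ln2.
have lp2 : 0 < ln p%:R ^+ 2 :> R by rewrite exprn_gt0//; lra.
have mB := measurable_closed_ball y rho.
have pV : (p%:R + 1)^-1 <= p%:R^-1 :> R by rewrite lef_pV2 ?posrE; lra.
have [rp1|rp1] := leP rho (p%:R^-1).
  pose k := rho * p%:R ^+ 2 - 1.
  have k0 : 0 <= k by rewrite /k subr_ge0 -ler_pdivrMr// div1r.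
  have kp : k <= p%:R.
    have : rho * p%:R ^+ 2 <= p%:R^-1 * p%:R ^+ 2 by rewrite ler_wpM2r// ltW.
    by rewrite expr2 mulKf ?gt_eqF//; rewrite /k ?expr2; lra.
  have k0p : 0 <= k <= p%:R by rewrite k0.
  apply: (le_trans _ (prime_mass pp k0p mB _)).
    have K2p : 0 < K2 * ln p%:R ^+ 2.
      by rewrite mulr_gt0 ?K2_gt0.
    apply: ge0_ler_powR; rewrite ?nnegrE ?(ltW d0)//.
    - exact: divr_ge0 (ltW r0) (ltW K2p).
    - exact: divr_ge0 (addr_ge0 k0 ler01) (ltW (mulr_gt0 K1_gt0 (mulr_gt0 pp0 lp2))).
    have -> : (k + 1) / (K1 * (p%:R ^+ 2 * ln p%:R ^+ 2)) = rho / (K1 * ln p%:R ^+ 2).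
      by rewrite /k; field; rewrite !gt_eqF//; lra.
    rewrite ler_wpM2l ?(ltW r0)// lef_pV2 ?posrE ?K2p ?(mulr_gt0 K1_gt0 lp2)//.
    by rewrite ler_wpM2r ?(ltW lp2)// /K2 ler_peMr ?(ltW K1_gt0)//; have := K0; lra.
  move=> q pq /andP[pq1 qk] z /(branch_itv pq)/andP[z1 z2].
  rewrite closed_ballE// /closed_ball_ /= ler_norml.
  have h1 : (p%:R^-1 : R) - (q%:R + 1)^-1 <= rho.
    have -> : (p%:R^-1 : R) - (q%:R + 1)^-1 = (q%:R + 1 - p%:R) / (p%:R * (q%:R + 1)).
      by field; rewrite !gt_eqF//; lra.
    have p0q : 0 < p%:R * (q%:R + 1) :> R by rewrite mulr_gt0//; lra.
    rewrite ler_pdivrMr//.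
    apply: (@le_trans _ _ (rho * p%:R ^+ 2)); first by rewrite /k in qk; lra.
    by rewrite ler_wpM2l ?(ltW r0)// expr2 ler_wpM2l//; lra.
  have h2 : q%:R^-1 <= p%:R^-1 :> R by rewrite lef_pV2 ?posrE; lra.
  have h3 : (q%:R + 1)^-1 <= (p%:R + 1)^-1 :> R by rewrite lef_pV2 ?posrE; lra.
  by apply/andP; split; lra.
have [i ip imin] : exists2 i, rho^-1 <= (nth_prime i)%:R &
    forall j, rho^-1 <= (nth_prime j)%:R -> (i <= j)%N.
  have [i0 i0p] := nth_prime_surj pp.
  have ex : exists i, rho^-1 <= (nth_prime i)%:R.
    by exists i0; rewrite i0p invf_ple ?posrE//; [exact: ltW|lra].
  by case: (ex_minnP ex) => i h1 h2; exists i.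
set m := nth_prime i in ip.
have pm : prime m by exact: prime_nth_prime.
have m2 : 2 <= m%:R :> R by rewrite ler_nat prime_gt1.
have mp : (m <= p)%N.
  have [i0 i0p] := nth_prime_surj pp.
  rewrite -i0p nth_prime_mono; apply: imin.
  by rewrite i0p invf_ple ?posrE//; [exact: ltW|lra].
(* The prime x before m is below 1/rho and the gap after it is at most 4K x, so m rho <= 1 + 4K; for
   m = 2 the bound rho <= 4 gives 8. *)
have mrho : m%:R * rho <= 9 + 4 * K.
  rewrite /m; case: (i) imin => [_|j imin]; first by have := K0; rewrite /=; nra.
  set x : R := (nth_prime j)%:R.
  have xr : x < rho^-1.
    by rewrite ltNge; apply/negP => /imin; rewrite ltnn.
  have x1 : 1 <= x by rewrite ler1n prime_gt0// prime_nth_prime.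
  rewrite nth_prime_gap natrD -/x.
  have h1 := hK j; have h2 := ln_sqr_le x1.
  have h3 : (gap j)%:R <= K * (4 * x).
    by apply: (le_trans h1); rewrite ler_wpM2l ?(ltW K0).
  have h4 : x * rho <= 1 by rewrite -ler_pdivlMr// div1r ltW.
  have h5 : (gap j)%:R * rho <= K * (4 * x) * rho by rewrite ler_wpM2r// ltW.
  have h6 : 4 * K * (x * rho) <= 4 * K by rewrite ler_piMr//; have := K0; lra.
  have E : K * (4 * x) * rho = 4 * K * (x * rho) by ring.
  by rewrite E in h5; rewrite mulrDl; lra.
have km : 0 <= (m%:R : R) <= m%:R by rewrite lexx andbT.
apply: (le_trans _ (prime_mass pm km mB _)).
  have lm := ln_prime pm.
  have lm2 : 0 < ln m%:R ^+ 2 :> R by rewrite exprn_gt0//; lra.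
  have K90 : 0 < 9 + 4 * K by have := K0; lra.
  have m0 : 0 < m%:R :> R by lra.
  have mm0 : 0 < m%:R ^+ 2 :> R by rewrite exprn_gt0.
  apply: ge0_ler_powR; rewrite ?nnegrE ?(ltW d0)//.
  - exact: divr_ge0 (ltW r0) (ltW (mulr_gt0 K2_gt0 lp2)).
  - exact: divr_ge0 (addr_ge0 (ltW m0) ler01) (ltW (mulr_gt0 K1_gt0 (mulr_gt0 mm0 lm2))).
  apply: (@le_trans _ _ (m%:R / (K1 * (m%:R ^+ 2 * ln m%:R ^+ 2)))); last first.
    by rewrite ler_wpM2r ?lerDl// invr_ge0 (ltW (mulr_gt0 K1_gt0 (mulr_gt0 mm0 lm2))).
  have -> : m%:R / (K1 * (m%:R ^+ 2 * ln m%:R ^+ 2)) = (K1 * ln m%:R ^+ 2 * m%:R)^-1.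
    by field; rewrite !gt_eqF//; lra.
  rewrite -[leLHS]invf_div lef_pV2 ?posrE ?divr_gt0 ?(mulr_gt0 K2_gt0 lp2)
    ?(mulr_gt0 (mulr_gt0 K1_gt0 lm2) m0)//.
  rewrite ler_pdivlMr//.
  have -> : K1 * ln m%:R ^+ 2 * m%:R * rho = K1 * ((m%:R * rho) * ln m%:R ^+ 2) by ring.
  rewrite -[leRHS]mulrA ler_wpM2l ?(ltW K1_gt0)//.
  have lmp : ln m%:R ^+ 2 <= ln p%:R ^+ 2 :> R.
    rewrite lerXn2r ?nnegrE//; [lra|lra|].
    by rewrite ler_ln ?posrE ?ler_nat//; lra.
  by apply: ler_pM; [rewrite mulr_ge0 ?(ltW r0)|exact: ltW| |].
(* Both z and y lie in [0, rho], since 1/q <= 1/m <= rho and 1/p < rho. *)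
move=> q pq /andP[mq _] z /(branch_itv pq)/andP[z1 z2].
rewrite closed_ballE// /closed_ball_ /= ler_norml.
have h1 : q%:R^-1 <= m%:R^-1 :> R by rewrite lef_pV2 ?posrE; lra.
have h2 : m%:R^-1 <= rho by rewrite invf_ple ?posrE//; lra.
have h3 : 0 <= (q%:R + 1)^-1 :> R by rewrite invr_ge0; lra.
have h4 : 0 <= (p%:R + 1)^-1 :> R by rewrite invr_ge0; lra.
by apply/andP; split; lra.
Qed.

Lemma ball_mass_ex : exists2 C : R, 0 < C & forall p y rho, prime p ->
  branch p X y -> p%:R ^- 2 <= rho <= 4 ->
  (rho / (C * ln p%:R ^+ 2)) `^ delta <= mass (closed_ball y rho).
Proof. by exists K2; [exact: K2_gt0|exact: ball_mass]. Qed.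

End BallMass.

(** * Every small ball around almost every point is heavy *)

Section UpperDensity.
Variables (R : realType) (delta : R) (mu : {measure set R -> \bar R}).
Hypothesis cmu : conformal delta mu.
Local Notation X := (@LambdaP R).
Local Notation T := (@gauss R).
Local Notation digit := (@cf_entry R).
Local Notation mass := (mass mu).
Local Notation mX := (@measurable_LambdaP R).

Lemma cyl_closed_ball n x s : X x -> 0 < s ->
  cyl (pref n x) (closed_ball (iter n T x) (s * qden R (pref n x) ^+ 2)) `<=`
  closed_ball x s.
Proof.
move=> Xx s0 z [Xz []]; rewrite size_pref => zx.
have pw := prime_pref n Xx; have D1 := qden_ge1 R pw.
have DD : 0 < qden R (pref n x) ^+ 2 by rewrite exprn_gt0// (lt_le_trans ltr01).
rewrite !closed_ballE ?(mulr_gt0 s0 DD)// /closed_ball_ /= => h.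
have [/andP[/ltW x0 _] _] := LambdaP_iter n Xx.
have [/andP[/ltW z0 _] _] := LambdaP_iter n Xz.
rewrite [x in X in X <= _](LambdaP_mobius n Xx) (LambdaP_mobius n Xz) zx.
by rewrite (le_trans (mobius_dist_le pw x0 z0))// ler_pdivrMr.
Qed.

Lemma qden_prefS n x : X x ->
  2 * qden R (pref n x) <= qden R (pref n.+1 x) /\
  qden R (pref n.+1 x) <= 2 * (digit x n)%:R * qden R (pref n x).
Proof.
move=> Xx; have pw := prime_pref n Xx; have pd := prime_digit n Xx.
rewrite prefS; have /andP[h ->] := qden_rcons R pw pd; split=> //.
apply: le_trans h; rewrite ler_wpM2r ?ler_nat ?prime_gt1//.
by rewrite (le_trans ler01) ?qden_ge1.
Qed.

Lemma qden_pref_mono x : X x -> {homo (fun n => qden R (pref n x)) : m n / (m <= n)%N >-> m <= n}.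
Proof.
move=> Xx; apply: homo_leq => [//|a b c|n]; first exact: le_trans.
have [+ _] := qden_prefS n Xx; apply: le_trans.
by have := qden_ge1 R (prime_pref n Xx); lra.
Qed.

(** Take the first n with s q_(n+1)^2 > 4. Since q_(n+1) <= 2 p q_n, the radius s q_n^2 exceeds
    p^-2. *)
Lemma scale_exists x s N : X x -> 0 < s -> s * qden R (pref N x) ^+ 2 <= 4 ->
  exists n, [/\ (N <= n)%N, s * qden R (pref n x) ^+ 2 <= 4 &
    (digit x n)%:R ^- 2 <= s * qden R (pref n x) ^+ 2].
Proof.
move=> Xx s0 sN.
have ex : exists n, 4 < s * qden R (pref n.+1 x) ^+ 2.
  exists (Num.truncn (4 / s)); set m := Num.truncn _.
  rewrite mulrC -ltr_pdivrMr//; apply: (lt_le_trans (truncnS_gt _)).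
  have hD := qden_size R (prime_pref m.+1 Xx); rewrite size_pref in hD.
  have h1 : m.+1%:R <= 2 ^+ m.+1 :> R by rewrite -natrX ler_nat ltnW// ltn_expl.
  have h2 : 1 <= qden R (pref m.+1 x) := qden_ge1 R (prime_pref m.+1 Xx).
  by rewrite expr2; nra.
case: (ex_minnP ex) => n hn nmin; exists n.
have Dpos k : 0 < qden R (pref k x).
  by rewrite (lt_le_trans ltr01)// qden_ge1// prime_pref.
have mono a b : (a <= b)%N -> s * qden R (pref a x) ^+ 2 <= s * qden R (pref b x) ^+ 2.
  move=> ab; rewrite ler_wpM2l ?(ltW s0)// lerXn2r ?nnegrE ?(ltW (Dpos _))//.
  exact: (qden_pref_mono Xx).
split.
- rewrite leqNgt; apply/negP => nN; have := mono _ _ nN.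
  by move=> /(lt_le_trans hn); rewrite ltNge sN.
- case: n hn nmin => [_ _|n hn nmin].
    exact: le_trans (mono _ _ (leq0n N)) sN.
  by rewrite leNgt; apply/negP => /nmin; rewrite ltnn.
- have [_ h] := qden_prefS n Xx.
  have p1 : 1 <= (digit x n)%:R :> R by rewrite ler1n prime_gt0// prime_digit.
  set p : R := (digit x n)%:R in h p1 *.
  have D0 := Dpos n; set d := qden R (pref n x) in h D0 *.
  have p20 : 0 < p ^+ 2 by rewrite exprn_gt0// (lt_le_trans ltr01).
  rewrite -div1r ler_pdivrMr//.
  have h3 : qden R (pref n.+1 x) ^+ 2 <= (2 * p * d) ^+ 2.
    rewrite lerXn2r ?nnegrE ?(ltW (Dpos _))//.
    by rewrite !mulr_ge0 ?(ltW D0)//; lra.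
  have h4 : s * qden R (pref n.+1 x) ^+ 2 <= s * (2 * p * d) ^+ 2.
    by rewrite ler_wpM2l ?(ltW s0).
  have E : s * (2 * p * d) ^+ 2 = 4 * (s * d ^+ 2 * p ^+ 2) by ring.
  by rewrite E in h4; lra.
Qed.

(** As s <= 4 / 4^n, ln(1/(4s)) >= (2n - 4) ln 2 >= n - 2; and (n-2)^2 >= n + 1 for n >= 5. Using C
    + 1 keeps the divisor positive. *)
Lemma lnln_scale (C n p : nat) (s : R) (d : R) : (5 <= n)%N -> prime p ->
  (p <= n.+1 ^ C)%N -> 0 < s -> 2 ^+ n <= d -> s * d ^+ 2 <= 4 ->
  ln p%:R / (2 * C.+1%:R) <= ln (ln (1 / (4 * s))).
Proof.
move=> n5 pp pC s0 dn sd.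
have l2 := ln2_ge_half R.
have n5' : 5 <= n%:R :> R by rewrite ler_nat.
have d0 : 0 < d by apply: lt_le_trans dn; rewrite exprn_gt0.
have p0 : 0 < p%:R :> R by rewrite ltr0n prime_gt0.
have h1 : n%:R - 2 <= ln (1 / (4 * s)).
  have e1 : 2 ^+ n ^+ 2 / 16 <= 1 / (4 * s).
    rewrite ler_pdivlMr ?mulr_gt0//.
    have : s * 2 ^+ n ^+ 2 <= 4.
      apply: le_trans sd; rewrite ler_wpM2l ?(ltW s0)// lerXn2r ?nnegrE//.
      exact: ltW.
    by lra.
  apply: (@le_trans _ _ (ln (2 ^+ n ^+ 2 / 16))); last first.
    by rewrite ler_ln ?posrE ?divr_gt0 ?exprn_gt0 ?mulr_gt0.
  have -> : 2 ^+ n ^+ 2 / 16 = 2 ^+ (n * 2 - 4) :> R.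
    have -> : (16 : R) = 2 ^+ 4 by rewrite -natrX.
    rewrite -exprM; have {1}-> : (n * 2 = (n * 2 - 4) + 4)%N by lia.
    by rewrite exprD mulfK// expf_neq0.
  rewrite lnXn// -[_ *+ (n * 2 - 4)]mulr_natr natrB; last by lia.
  rewrite natrM; nra.
have h2 : 0 < n%:R - 2 :> R by lra.
apply: (@le_trans _ _ (ln (n%:R - 2))); last by rewrite ler_ln ?posrE//; lra.
have h3 : ln n.+1%:R <= 2 * ln (n%:R - 2) :> R.
  rewrite mulr_natl -lnXn// ler_ln ?posrE ?exprn_gt0//.
  by rewrite -natr1 expr2; nra.
have h4 : ln p%:R <= C.+1%:R * ln n.+1%:R :> R.
  have pnC : p%:R <= n.+1%:R ^+ C.+1 :> R.
    by rewrite -natrX ler_nat (leq_trans pC)// leq_pexp2l.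
  have nC0 : 0 < n.+1%:R ^+ C.+1 :> R by rewrite exprn_gt0.
  by rewrite mulr_natl -lnXn// ler_ln ?posrE.
rewrite ler_pdivrMr ?mulr_gt0//; apply: (le_trans h4).
have -> : ln (n%:R - 2) * (2 * C.+1%:R) = C.+1%:R * (2 * ln (n%:R - 2)) :> R by ring.
by rewrite ler_wpM2l.
Qed.

Lemma upper_density : (Rk R 1 < +oo)%E ->
  exists (c : R) (N : set R), [/\ 0 < c, measurable N, mu N = 0%E &
    forall x, ~ N x -> exists2 e, 0 < e & forall r, 0 < r <= e ->
    ((psi_dim delta (2 * r))%:E <= c%:E * mu (closed_ball x (r / 2)))%E].
Proof.
move=> /(gap_bound (R := R))[K K0 hK].
have [C2 C20 hB] := ball_mass_ex cmu K0 hK.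
have [C [N [mN N0 growth]]] := digit_growth cmu.
have d0 : 0 < delta by have := delta_gt_half cmu; lra.
have k0 := distortion_gt0 delta.
(* One factor 4 comes from 2r = 4s, the other from squaring 2(C+1). *)
pose c := distortion delta * (16 * C.+1%:R ^+ 2 * C2) `^ delta.
have c0 : 0 < c by rewrite mulr_gt0// powR_gt0// !mulr_gt0// exprn_gt0.
exists c, (N `|` ~` X); split=> //.
- by apply: measurableU => //; apply: measurableC; exact: mX.
- apply/eqP; rewrite -measure_le0.
  have h := measureU2 mu mN (measurableC mX).
  apply: (le_trans h); have [_ [h2 _]] := cmu.
  have [a b] : (mu N <= 0 /\ mu (~` X) <= 0)%E by rewrite N0 h2.
  by rewrite -[leRHS]adde0; exact: leeD.
move=> x /not_orP[Nx /contrapT Xx].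
have [n0 hn0] := growth x Xx Nx.
pose N1 := maxn n0 5.
have DN := qden_ge1 R (prime_pref N1 Xx).
have DN2 : 0 < qden R (pref N1 x) ^+ 2 by rewrite exprn_gt0//; lra.
exists (8 / qden R (pref N1 x) ^+ 2); first by rewrite divr_gt0.
move=> r /andP[r0 rN]; set s := r / 2.
have s0 : 0 < s by rewrite divr_gt0.
have sN : s * qden R (pref N1 x) ^+ 2 <= 4.
  by rewrite -ler_pdivlMr// /s ler_pdivrMr// mulrAC (le_trans rN)//; lra.
have rs : 2 * r = 4 * s by rewrite /s; field.
clearbody s.
have [n [nN sn dn]] := scale_exists Xx s0 sN.
set w := pref n x in sn dn.
have pw : all prime w by exact: prime_pref.
have D1 := qden_ge1 R pw; have Dn := qden_size R pw; rewrite size_pref in Dn.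
have pp := prime_digit n Xx; set p := digit x n in pp dn.
have XTn := LambdaP_iter n Xx.
have by_ : branch p X (iter n T x).
  by split=> //; split=> //; have [_ _ h _] := LambdaP_gauss XTn.
have n0n : (n0 <= n)%N by rewrite (leq_trans _ nN)// leq_maxl.
have n5n : (5 <= n)%N by rewrite (leq_trans _ nN)// leq_maxr.
have LL := lnln_scale n5n pp (hn0 n n0n) s0 Dn sn.
have lp : 0 < ln p%:R :> R by rewrite ln_gt0// ltr1n prime_gt1.
have m1 : (s * qden R w ^+ 2 / (C2 * ln p%:R ^+ 2)) `^ delta <=
    mass (closed_ball (iter n T x) (s * qden R w ^+ 2)).
  by apply: hB => //; rewrite dn sn.
have mB := measurable_closed_ball (iter n T x) (s * qden R w ^+ 2).
have mBx := measurable_closed_ball x s.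
have m2 : mass (cyl w (closed_ball (iter n T x) (s * qden R w ^+ 2))) <= mass (closed_ball x s).
  by apply: (le_mass cmu) => //; [exact: measurable_cyl|exact: cyl_closed_ball].
have m3 := mass_cyl_ge cmu mB pw.
(* The measure lives on X, so intersecting with X changes no mass. *)
have EX : mass (X `&` closed_ball (iter n T x) (s * qden R w ^+ 2)) =
  mass (closed_ball (iter n T x) (s * qden R w ^+ 2)).
  rewrite [RHS](mass_setID cmu mB mX) setIC (_ : mass (_ `\` X) = 0) ?add0r//.
  apply/eqP; rewrite eq_le mass_ge0 andbT. 
  have [_ [h2 _]] := cmu.
  have -> : 0 = mass (~` X) by have := muE cmu (measurableC mX); rewrite h2 => -[].
  apply: (le_mass cmu); [exact: (measurableD mB mX)|exact: (measurableC mX)|by move=> z []].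
rewrite EX in m3.
rewrite (muE cmu)// -EFinM lee_fin.
have lp2 : 0 < ln p%:R ^+ 2 :> R by rewrite exprn_gt0.
have D20 : 0 < qden R w ^+ 2 by rewrite exprn_gt0//; lra.
have B1 : (distortion delta)^-1 * (s / (C2 * ln p%:R ^+ 2)) `^ delta <= mass (closed_ball x s).
  apply: le_trans m2; apply: le_trans m3; apply: (@le_trans _ _
    ((distortion delta)^-1 * qden R w `^ (- (2 * delta)) * (s * qden R w ^+ 2 / (C2 * ln p%:R ^+ 2)) `^ delta)).
    rewrite -mulrA ler_wpM2l ?invr_ge0 ?(ltW k0)//.
    have -> : qden R w `^ (- (2 * delta)) = ((qden R w ^+ 2)^-1) `^ delta.
      by rewrite -[qden R w ^+ 2]powR_mulrn ?(le_trans ler01)// -powRN -powRrM; congr (_ `^ _); ring.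
    rewrite -powRM ?invr_ge0 ?(ltW D20)//; last first.
      exact: divr_ge0 (mulr_ge0 (ltW s0) (ltW D20)) (mulr_ge0 (ltW C20) (ltW lp2)).
    rewrite le_eqVlt; apply/orP; left; apply/eqP; congr (_ `^ _).
    by field; rewrite !gt_eqF//; lra.
  by rewrite ler_wpM2l// mulr_ge0 ?powR_ge0 ?invr_ge0 ?(ltW k0).
apply: (@le_trans _ _ (c * ((distortion delta)^-1 * (s / (C2 * ln p%:R ^+ 2)) `^ delta))); last first.
  by rewrite ler_wpM2l ?(ltW c0).
have -> : c * ((distortion delta)^-1 * (s / (C2 * ln p%:R ^+ 2)) `^ delta) =
   (16 * C.+1%:R ^+ 2 * C2) `^ delta * (s / (C2 * ln p%:R ^+ 2)) `^ delta.
  by rewrite /c; field; rewrite gt_eqF.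
rewrite /psi_dim rs.
set L := ln (ln _) in LL *.
have q0 : 0 < ln p%:R / (2 * C.+1%:R) :> R by rewrite divr_gt0// mulr_gt0.
apply: (@le_trans _ _ ((4 * s) `^ delta * (ln p%:R / (2 * C.+1%:R)) `^ (- (2 * delta)))).
  by rewrite ler_wpM2l ?powR_ge0//; apply: powR_antimono => //; rewrite mulr_ge0// ltW.
have -> : (ln p%:R / (2 * C.+1%:R)) `^ (- (2 * delta)) =
   (((ln p%:R / (2 * C.+1%:R)) ^+ 2)^-1) `^ delta.
  by rewrite -[(ln _ / _) ^+ 2]powR_mulrn ?(ltW q0)// -powRN -powRrM; congr (_ `^ _); ring.
have q20 : 0 < (ln p%:R / (2 * C.+1%:R)) ^+ 2 :> R by rewrite exprn_gt0.
have C16 : 0 <= 16 * C.+1%:R ^+ 2 * C2 by rewrite !mulr_ge0 ?exprn_ge0 ?(ltW C20).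
have s40 : 0 <= 4 * s by rewrite mulr_ge0 ?(ltW s0).
have sC : 0 <= s / (C2 * ln p%:R ^+ 2).
  exact: divr_ge0 (ltW s0) (mulr_ge0 (ltW C20) (ltW lp2)).
rewrite -powRM ?invr_ge0 ?(ltW q20)// -powRM//.
rewrite le_eqVlt; apply/orP; left; apply/eqP; congr (_ `^ _).
by field; rewrite !gt_eqF//=; lra.
Qed.

End UpperDensity.

(** * Geometry of a ball around a point with an isolated digit *)

Section LowerDensity.
Variable R : realType.
Local Notation X := (@LambdaP R).
Local Notation T := (@gauss R).
Local Notation digit := (@cf_entry R).
Implicit Types (w : seq nat).

Lemma cnd_affine w (x y : R) :
  num w x = num w y + (x - y) * (num w 1 - num w 0) /\
  den w x = den w y + (x - y) * (den w 1 - den w 0).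
Proof.
elim: w => [|a w [h1 h2]]; first by rewrite /num /den /=; split; ring.
by rewrite !num_cons !den_cons h1 h2; split; ring.
Qed.

Lemma cnd_det_sign w (x y : R) :
  num w x * den w y - num w y * den w x = (-1) ^+ size w * (x - y).
Proof.
elim: w => [|a w IH]; first by rewrite /num /den /= mul1r !mulr1.
rewrite !num_cons !den_cons /= exprS mulN1r mulNr -IH; ring.
Qed.

(** Solves phi_w(t) = phi_w(y) + h explicitly: the denominator is affine in t and the determinant is
    ±1, so t - y = h v^2 / (e - h c v). The equation is stated without division because [den w t] is
    not yet known to be nonzero. *)
Lemma mobius_inverse w (y h : R) : all prime w -> 0 <= y <= 1 ->
  `|h| * (4 * qden R w ^+ 2) <= 1 ->
  exists2 t, `|t - y| <= 8 * `|h| * qden R w ^+ 2 &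
    num w t = (num w y / den w y + h) * den w t.
Proof.
move=> pw /andP[y0 y1] hD.
have [_ _ D1 dy [dy2 _]] := cnd_bounds pw y0.
have [_ _ _ e1 [e2 _]] := cnd_bounds pw (ler01 : 0 <= 1 :> R).
set d := qden R w in hD D1 dy dy2 e1 e2 *.
set e : R := (-1) ^+ size w; set v := den w y in dy dy2 *.
pose c : R := den w 1 - den w 0.
have c0 : 0 <= c <= d by rewrite /c -/(qden R w) -/d; apply/andP; split; lra.
have v0 : 0 < v by lra.
have v2 : v <= 2 * d by nra.
have /andP[c1 c2] := c0.
have cv : 0 <= c * v <= 2 * d ^+ 2 by rewrite expr2; apply/andP; split; nra.
have /andP[cv1 cv2] := cv.
have hcv : `|h * (c * v)| <= 2^-1.
  rewrite normrM (ger0_norm cv1); have := normr_ge0 h; nra.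
have ne : `|e| = 1 by rewrite /e normrX normrN1 expr1n.
(* This halves the divisor at worst; with v <= 2 q the shift is at most 8 |h| q^2. *)
have den0 : 2^-1 <= `|e - h * (c * v)|.
  by have := lerB_dist e (h * (c * v)); rewrite ne; lra.
have dn0 : e - h * (c * v) != 0 by rewrite -normr_gt0; lra.
exists (y + h * v ^+ 2 / (e - h * (c * v))).
  rewrite addrC addKr normrM normfV normrM ler_pdivrMr; last lra.
  rewrite (ger0_norm (sqr_ge0 v)).
  have h0 := normr_ge0 h.
  have vv : v ^+ 2 <= 4 * d ^+ 2 by rewrite !expr2; nra.
  have hv : `|h| * v ^+ 2 <= `|h| * (4 * d ^+ 2) by rewrite ler_wpM2l.
  apply: (le_trans hv).
  have hd0 : 0 <= 8 * `|h| * d ^+ 2.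
    by apply: mulr_ge0 (sqr_ge0 d); exact: mulr_ge0.
  nra.
set t := y + _.
have E1 := cnd_det_sign w t y; rewrite -/e -/v in E1.
have [_ E2] := cnd_affine w t y; rewrite -/v -/c in E2.
have E3 : (t - y) * (e - h * (c * v)) = h * v ^+ 2.
  by rewrite /t addrC addKr divfK.
apply: (mulIf (lt0r_neq0 v0)).
have -> : (num w y / v + h) * den w t * v = num w y * den w t + h * v * den w t.
  by field; rewrite gt_eqF.
have -> : num w t * v = e * (t - y) + num w y * den w t by lra.
rewrite addrC; congr (_ + _); rewrite E2; lra.
Qed.

Lemma pref_mobius w (t : R) : all prime w -> 0 < t < 1 ->
  pref (size w) (num w t / den w t) = w /\
  iter (size w) T (num w t / den w t) = t /\ 0 < num w t / den w t < 1.
Proof.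
move=> + t01; elim: w => [_|a w IH /= /andP[pa pw]].
  by rewrite /num /den /= divr1.
have [h1 [h2 h3]] := IH pw.
have /andP[t0 t1] := t01.
have [n1 n2 n3 n4 _] := cnd_bounds pw (ltW t0).
have v0 : 0 < den w t by lra.
have E : num (a :: w) t / den (a :: w) t = (a%:R + num w t / den w t)^-1.
  rewrite num_cons den_cons; have -> : a%:R + num w t / den w t =
    (num w t + a%:R * den w t) / den w t by field; rewrite gt_eqF.
  by rewrite invf_div.
rewrite E; have [e1 e2] := digitE (prime_gt0 pa) h3.
rewrite -iterS iterSr e1 e2 h1 h2; split=> //; split=> //.
have a2 : 2 <= a%:R :> R by rewrite ler_nat prime_gt1.
have /andP[f0 f1] := h3.
by rewrite invr_gt0 invf_lt1; lra.
Qed.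

Lemma LambdaP_branch (x : R) : X x -> branch (digit x 0) X x.
Proof. by move=> Xx; have [_ _ XT _] := LambdaP_gauss Xx. Qed.

Definition isolated (c : R) (p g : nat) : Prop :=
  [/\ prime p, (2 <= g <= p)%N, c * ln p%:R ^+ 2 <= g%:R &
    forall q, prime q -> q != p -> (q + g <= p)%N || (p + g <= q)%N].

(** The other branches belong to q <= p - g or q >= p + g, and lie at distance at least g/(6 p^2)
    from the branch of p. The condition g >= 2 absorbs the width of a branch. *)
Lemma isolated_dist c p g (y t : R) : isolated c p g -> branch p X y -> X t ->
  `|t - y| <= g%:R / (10 * p%:R ^+ 2) -> branch p X t.
Proof.
move=> [pp /andP[g2 gp] _ iso] py Xt ty.
have /andP[y1 y2] := branch_itv pp py.
have bt := LambdaP_branch Xt; have pq := prime_digit 0 Xt.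
set q := digit t 0 in bt pq.
have /andP[t1 t2] := branch_itv pq bt.
have [<-//|qp] := eqVneq q p; exfalso.
have G2 : 2 <= g%:R :> R by rewrite ler_nat.
have GP : g%:R <= p%:R :> R by rewrite ler_nat.
set P : R := p%:R in y1 y2 ty GP; set G : R := g%:R in ty G2 GP.
have P0 : 0 < P by lra.
have PP : 0 < P ^+ 2 by rewrite exprn_gt0.
have small : G / (10 * P ^+ 2) = 10^-1 * (G / P ^+ 2) by field; rewrite gt_eqF.
have GPP : 0 < G / P ^+ 2 by rewrite divr_gt0//; lra.
move: ty; rewrite small ler_norml => /andP[ty1 ty2].
have /orP[qg|qg] := iso q pq qp.
  have qg' : q%:R + G <= P by rewrite /G /P -natrD ler_nat.
  have q0 : 0 <= q%:R :> R by [].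
  have : P^-1 + 2^-1 * (G / P ^+ 2) <= (q%:R + 1)^-1.
    rewrite -subr_ge0.
    have -> : (q%:R + 1)^-1 - (P^-1 + 2^-1 * (G / P ^+ 2)) =
       (P ^+ 2 * 2 - (P * 2 + G) * (q%:R + 1)) / (2 * P ^+ 2 * (q%:R + 1)).
      by field; rewrite !gt_eqF//; lra.
    have den0 : 0 < 2 * P ^+ 2 * (q%:R + 1) by rewrite !mulr_gt0//; lra.
    apply: divr_ge0 (ltW den0).
    have : (P * 2 + G) * (q%:R + 1) <= (P * 2 + G) * (P - G + 1).
      by rewrite ler_wpM2l//; lra.
    by rewrite expr2; nra.
  by lra.
have qg' : P + G <= q%:R by rewrite /G /P -natrD ler_nat.
have : q%:R^-1 + 6^-1 * (G / P ^+ 2) <= (P + 1)^-1.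
  apply: (@le_trans _ _ ((P + G)^-1 + 6^-1 * (G / P ^+ 2))).
    by rewrite lerD2r lef_pV2 ?posrE; lra.
  rewrite -subr_ge0.
  have -> : (P + 1)^-1 - ((P + G)^-1 + 6^-1 * (G / P ^+ 2)) =
     (6 * P ^+ 2 * (G - 1) - G * (P + 1) * (P + G)) / (6 * P ^+ 2 * ((P + 1) * (P + G))).
    by field; rewrite !gt_eqF//; lra.
  have den0 : 0 < 6 * P ^+ 2 * ((P + 1) * (P + G)).
    by rewrite mulr_gt0 ?mulr_gt0//; lra.
  apply: divr_ge0 (ltW den0).
  have a1 : (P + 1) * (P + G) <= (3 / 2 * P) * (2 * P) by rewrite ler_pM//; lra.
  have a2 : G * ((P + 1) * (P + G)) <= G * (3 * P ^+ 2).
    by rewrite ler_wpM2l// expr2; lra.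
  have a3 : 3 * P ^+ 2 * G <= 6 * P ^+ 2 * (G - 1) by nra.
  by lra.
by lra.
Qed.

(** A nearby z is not assumed to share the prefix w. It is pulled back to t by [mobius_inverse], t
    is shown to lie in (0,1), which forces the prefix, and then [isolated_dist] gives the digit p.
    The 400 is chosen so that 8 times the radius times q^2 equals g/(10 p^2). *)
Lemma isolated_ball c p g n (x : R) : isolated c p g -> X x -> digit x n = p ->
  closed_ball x (5 * (g%:R / (400 * p%:R ^+ 2 * qden R (pref n x) ^+ 2))) `&` X `<=`
  cyl (pref n x) (branch p X).
Proof.
move=> iso Xx xp z [+ Xz].
have [pp /andP[g2 gp] _ _] := iso.
have pw := prime_pref n Xx; have D1 := qden_ge1 R pw.
set w := pref n x in pw D1 *; set y := iter n T x.
have Xy : X y by exact: LambdaP_iter.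
have py : branch p X y by rewrite -xp; exact: LambdaP_branch Xy.
have /andP[y1 y2] := branch_itv pp py.
have [/andP[y0 y01] _] := Xy.
have G2 : 2 <= g%:R :> R by rewrite ler_nat.
have GP : g%:R <= p%:R :> R by rewrite ler_nat.
set P : R := p%:R in y1 y2 GP *; set G : R := g%:R in G2 GP *.
set d := qden R w in D1 *.
have P0 : 0 < P by lra.
have PP : 0 < P ^+ 2 by rewrite exprn_gt0.
have DD : 0 < d ^+ 2 by rewrite exprn_gt0//; lra.
have r0 : 0 < 5 * (G / (400 * P ^+ 2 * d ^+ 2)).
  by rewrite mulr_gt0// divr_gt0 ?mulr_gt0//; lra.
rewrite closed_ballE// /closed_ball_ /= => xz.
pose h := z - x.
have hle : 8 * `|h| * d ^+ 2 <= G / (10 * P ^+ 2).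
  rewrite /h distrC.
  have -> : G / (10 * P ^+ 2) = 8 * (5 * (G / (400 * P ^+ 2 * d ^+ 2))) * d ^+ 2.
    by field; rewrite !gt_eqF//; lra.
  by rewrite ler_wpM2r ?(ltW DD)// ler_wpM2l.
have gp1 : G / (10 * P ^+ 2) <= (10 * P)^-1.
  have -> : (10 * P)^-1 = P / (10 * P ^+ 2) by field; rewrite gt_eqF.
  by rewrite ler_wpM2r// invr_ge0 mulr_ge0// ltW.
have pinv : P^-1 <= 2^-1 by rewrite lef_pV2 ?posrE; lra.
have p10 : (10 * P)^-1 = 10^-1 * P^-1 by rewrite invfM.
have pi0 : 0 < P^-1 by rewrite invr_gt0.
have h4 : `|h| * (4 * d ^+ 2) <= 1.
  have -> : `|h| * (4 * d ^+ 2) = 2^-1 * (8 * `|h| * d ^+ 2) by field.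
  lra.
have y01' : 0 <= y <= 1 by rewrite !ltW.
have [t tle tE] := mobius_inverse pw y01' h4.
have xE : num w y / den w y = x by rewrite -(LambdaP_mobius n Xx).
have ty : `|t - y| <= G / (10 * P ^+ 2) by exact: le_trans hle.
have t01 : 0 < t < 1.
  have := le_trans ty gp1; rewrite p10 ler_norml => /andP[ty1 ty2].
  have : 2^-1 * P^-1 <= (P + 1)^-1.
    by rewrite -invfM lef_pV2 ?posrE; lra.
  by move=> hp; apply/andP; split; lra.
have /andP[t0 t1] := t01.
have [_ _ _ dt _] := cnd_bounds pw (ltW t0).
have zE : z = num w t / den w t.
  rewrite tE xE /h addrC subrK mulfK// gt_eqF//.
  by rewrite (lt_le_trans _ dt)//; lra.
have [e1 [e2 _]] := pref_mobius pw t01.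
rewrite -zE in e1 e2.
split=> //; split=> //; rewrite e2.
apply: (isolated_dist iso py) => //.
by rewrite -e2; exact: LambdaP_iter.
Qed.

End LowerDensity.

(** * Almost every point meets isolated primes early *)

Section Hitting.
Variables (R : realType) (delta : R) (mu : {measure set R -> \bar R}).
Hypothesis cmu : conformal delta mu.
Local Notation X := (@LambdaP R).
Local Notation T := (@gauss R).
Local Notation digit := (@cf_entry R).
Local Notation mass := (mass mu).
Local Notation mX := (@measurable_LambdaP R).

Definition avoid p n : set R := [set x | X x /\ p \notin pref n x].

Lemma avoidS p n : avoid p n.+1 = avoid p n `&` [set x | X x /\ digit x n <> p].
Proof.
apply/seteqP; split=> x; rewrite /avoid /mkset prefS mem_rcons inE negb_or.
  by move=> [Xx /andP[/eqP h1 h2]]; split=> //; split=> // h; apply: h1.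
by move=> [[Xx h1] [_ h2]]; split=> //; rewrite h1 andbT; apply/eqP => h; apply: h2.
Qed.

Lemma measurable_avoid p n : measurable (avoid p n).
Proof.
elim: n => [|n IH].
  have -> : avoid p 0 = X by apply/seteqP; split=> x; [case|split].
  exact: mX.
rewrite avoidS; apply: measurableI => //.
exact: (@measurable_digit R n (fun d => d <> p)).
Qed.

(** A lower bound, uniform in the past digits, for the conditional probability that the next digit
    is p. *)
Let hit p : R := distortion delta ^- 2 * mass (branch p X).

Let hit01 p : 0 <= hit p <= 1.
Proof.
have k0 := distortion_gt0 delta.
have mb := @measurable_branchX R p.
have h0 : 0 <= distortion delta ^- 2 by rewrite invr_ge0 exprn_ge0// ltW.
rewrite /hit mulr_ge0 ?mass_ge0//=.
have := mass_cyl_quasi_ge cmu mb (isT : all prime [::]).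
have XB : X `&` branch p X = branch p X.
  by apply/seteqP; split=> [z []//|z bz]; split=> //; case: bz.
rewrite !cyl_nil setIT (mass_LambdaP cmu) mulr1 XB => /le_trans; apply.
exact: (mass_le1 cmu).
Qed.

Lemma mass_avoidS p n : mass (avoid p n.+1) <= (1 - hit p) * mass (avoid p n).
Proof.
have /andP[h0 h1] := hit01 p.
have mb := @measurable_branchX R p.
have AX k : avoid p k `&` X = avoid p k.
  by apply/seteqP; split=> [z []//|z az]; split=> //; case: az.
rewrite -(AX n.+1) -(AX n).
apply: (mass_partition cmu (n := n)); [exact: measurable_avoid..|by rewrite subr_ge0|].
move=> w sw pw.
have mc B : measurable B -> measurable (cyl w B) by move=> mB; exact: measurable_cyl.
have [pin|pnin] := boolP (p \in w).
  have -> : avoid p n.+1 `&` cyl w setT = set0.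
    apply/seteqP; split=> x // [[_ h] [_ [wx _]]]; move: h.
    by rewrite prefS mem_rcons inE -sw wx pin orbT.
  by rewrite mass0 mulr_ge0 ?mass_ge0// subr_ge0.
have -> : avoid p n `&` cyl w setT = cyl w setT.
  apply/seteqP; split=> [x []//|x cx]; split=> //.
  by have [Xx [wx _]] := cx; split=> //; rewrite -sw wx.
have h2 : avoid p n.+1 `&` cyl w setT `<=` cyl w setT `\` cyl w (branch p X).
  move=> x [ax cx]; split=> // -[Xx [wx [_ [px _]]]].
  move: ax; rewrite avoidS => -[_ [_]]; apply.
  by rewrite /cf_entry -sw.
have := mass_cyl_quasi_ge cmu mb pw.
have XB : X `&` branch p X = branch p X.
  by apply/seteqP; split=> [z []//|z bz]; split=> //; case: bz.
rewrite XB -/(hit p) => h3.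
have mcT : measurable (cyl w [set: R]) by exact: mc.
have mcb : measurable (cyl w (branch p X)) by exact: mc.
have := mass_setID cmu mcT mcb.
have -> : cyl w setT `&` cyl w (branch p X) = cyl w (branch p X).
  by apply/seteqP; split=> [z []//|z [? [? ?]]]; split.
move=> h4.
have h5 : mass (avoid p n.+1 `&` cyl w setT) <= mass (cyl w setT `\` cyl w (branch p X)).
  apply: (le_mass cmu) => //; last exact: measurableD.
  by apply: measurableI => //; exact: measurable_avoid.
by rewrite mulrBl mul1r; lra.
Qed.

(** A linear substitute for (1-h)^n, from (1-h)(1+(n+1)h) <= 1 + nh. *)
Lemma mass_avoid p n : mass (avoid p n) * (1 + n%:R * hit p) <= 1.
Proof.
have /andP[h0 h1] := hit01 p.
elim: n => [|n IH].
  by rewrite mul0r addr0 mulr1; apply: (mass_le1 cmu); exact: measurable_avoid.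
apply: le_trans IH; set a := mass (avoid p n).
have a0 : 0 <= a by exact: mass_ge0.
have n0 : 0 <= n%:R :> R by [].
have := mass_avoidS p n; rewrite -/a -natr1 => h.
apply: (@le_trans _ _ ((1 - hit p) * a * (1 + (n%:R + 1) * hit p))).
  by rewrite ler_wpM2r// addr_ge0// mulr_ge0// addr_ge0.
have -> : (1 - hit p) * a * (1 + (n%:R + 1) * hit p) =
  a * (1 + n%:R * hit p) - a * (n%:R + 1) * hit p ^+ 2 by ring.
by rewrite gerBl mulr_ge0 ?sqr_ge0// mulr_ge0// addr_ge0.
Qed.

(** As delta <= 1, [hit p] is at least of order p^-2, so p^3 trials suffice to make avoidance
    unlikely. *)
Lemma mass_avoid_cube p : prime p ->
  mass (avoid p (p ^ 3)) <= 4 * distortion delta ^+ 2 / p%:R.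
Proof.
move=> pp; have p2 : 2 <= p%:R :> R by rewrite ler_nat prime_gt1.
have k0 := distortion_gt0 delta; have k20 : 0 < distortion delta ^+ 2 by rewrite exprn_gt0.
have hp : (4 * p%:R ^+ 2 * distortion delta ^+ 2)^-1 <= hit p.
  rewrite invfM mulrC /hit ler_wpM2l ?invr_ge0 ?(ltW k20)//.
  apply: (le_trans _ (mass_branchX_ge cmu pp)).
  have -> : (4 * p%:R ^+ 2)^-1 = (2 * p%:R) `^ (- 2%:R) :> R.
    by rewrite powR_invn; [congr (_^-1); ring|lra].
  by apply: ler_powR; [lra|have := delta_le1 cmu; lra].
have := mass_avoid p (p ^ 3); set a := mass _ => h.
have a0 : 0 <= a by exact: mass_ge0.
have pp0 : 0 < p%:R :> R by lra.
have h2 : p%:R / (4 * distortion delta ^+ 2) <= 1 + (p ^ 3)%:R * hit p.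
  apply: (@le_trans _ _ ((p ^ 3)%:R * hit p)); last by rewrite lerDr.
  rewrite natrX; apply: (le_trans _ (ler_wpM2l _ hp)); last by rewrite exprn_ge0.
  rewrite le_eqVlt; apply/orP; left; apply/eqP.
  by field; rewrite !gt_eqF.
have -> : 4 * distortion delta ^+ 2 / p%:R = (p%:R / (4 * distortion delta ^+ 2))^-1.
  by rewrite invf_div.
rewrite -div1r ler_pdivlMr; last by rewrite divr_gt0// mulr_gt0.
by apply: le_trans h; rewrite ler_wpM2l.
Qed.

(** Avoiding every p >= M of S during its first p^3 digits has mass at most of order 1/p for
    arbitrarily large p, hence mass 0. *)
Lemma hitting (S : set nat) : S `<=` [set p | prime p] ->
  (forall M, exists2 p, (M <= p)%N & S p) ->
  exists N : set R, [/\ measurable N, mu N = 0%E &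
    forall x, X x -> ~ N x -> forall M, exists p n,
      [/\ (M <= p)%N, S p, (n < p ^ 3)%N & digit x n = p]].
Proof.
move=> Sp Sinf.
pose B M := \bigcap_(p in [set p | (M <= p)%N /\ S p]) avoid p (p ^ 3).
have mB M : measurable (B M).
  have [p Mp sp] := Sinf M.
  by apply: bigcap_measurable => [|k _]; [exists p|exact: measurable_avoid].
have B0 M : mu (B M) = 0%E.
  rewrite (muE cmu)//; congr EFin; apply/eqP; rewrite eq_le mass_ge0 andbT.
  apply/ler_addgt0Pr => e e0; rewrite add0r.
  pose Q := 4 * distortion delta ^+ 2 / e.
  have [p Mp sp] := Sinf (maxn M (Num.truncn Q).+1).
  have pp := Sp _ sp.
  apply: (@le_trans _ _ (mass (avoid p (p ^ 3)))).
    apply: (le_mass cmu) => //; first exact: measurable_avoid.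
    by move=> x; apply; split=> //; rewrite (leq_trans _ Mp)// leq_maxl.
  apply: (le_trans (mass_avoid_cube pp)).
  have p0 : 0 < p%:R :> R by rewrite ltr0n prime_gt0.
  have QP : Q <= p%:R.
    apply: (le_trans (ltW (truncnS_gt _))).
    by rewrite ler_nat (leq_trans _ Mp)// leq_maxr.
  by rewrite ler_pdivrMr// [e * _]mulrC -ler_pdivrMr.
exists (\bigcup_M B M); split.
- exact: bigcup_measurable.
- apply/eqP; rewrite -measure_le0.
  apply: (@le_trans _ _ (\sum_(M <oo) mu (B M))%E).
    by apply: measure_sigma_subadditive => //; exact: bigcup_measurable.
  by rewrite eseries0.
move=> x Xx nx M.
have : ~ B M x by move=> Bx; apply: nx; exists M.
move=> /existsNP[p /not_implyP[[Mp sp] ax]].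
have pin : p \in pref (p ^ 3) x.
  by apply: contrapT => /negP np; apply: ax; split.
have memP k : p \in pref k x -> exists2 n, (n < k)%N & digit x n = p.
  elim: k => [//|k IH]; rewrite prefS mem_rcons inE => /predU1P[->|/IH[n nk dn]].
    by exists k.
  by exists n => //; rewrite ltnW.
have [n n3 dn] := memP _ pin.
by exists p, n.
Qed.

End Hitting.

(** * Arbitrarily small light balls around almost every point *)

Section LowerDensityMeasure.
Variables (R : realType) (delta : R) (mu : {measure set R -> \bar R}).
Hypothesis cmu : conformal delta mu.
Local Notation X := (@LambdaP R).
Local Notation T := (@gauss R).
Local Notation digit := (@cf_entry R).
Local Notation mass := (mass mu).
Local Notation mX := (@measurable_LambdaP R).

(** Each digit adds at most ln 2 + ln(digit), which is at most linear in n; a quadratic bound is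
    enough later. *)
Lemma ln_qden_growth (C n0 : nat) (x : R) : X x ->
  (forall n, (n0 <= n)%N -> (digit x n <= n.+1 ^ C)%N) ->
  exists2 A : R, 0 <= A & forall n, ln (qden R (pref n x)) <= A * n.+1%:R ^+ 2.
Proof.
move=> Xx hC.
have lp n : 0 <= ln (digit x n)%:R :> R.
  by rewrite ln_ge0// ler1n prime_gt0// prime_digit.
pose A1 : R := \sum_(j < n0) ln (digit x j)%:R.
have A10 : 0 <= A1 by rewrite sumr_ge0.
have dig n : ln (digit x n)%:R <= A1 + C%:R * n.+1%:R.
  have [nn0|n0n] := ltnP n n0.
    apply: (@le_trans _ _ A1); last by rewrite lerDl mulr_ge0.
    by rewrite /A1 (bigD1 (Ordinal nn0))//= lerDl sumr_ge0.
  apply: (@le_trans _ _ (C%:R * n.+1%:R)); last by rewrite lerDr.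
  have p0 : 0 < (digit x n)%:R :> R by rewrite ltr0n prime_gt0// prime_digit.
  apply: (@le_trans _ _ (ln (n.+1%:R ^+ C))).
    by rewrite ler_ln ?posrE ?exprn_gt0// -natrX ler_nat hC.
  rewrite lnXn// -[_ *+ C]mulr_natl ler_wpM2l//.
  by rewrite ltW// ln_sublinear.
have l21 : ln 2 <= 1 :> R.
  rewrite -[leRHS]expRK ler_ln ?posrE ?expR_gt0//.
  by apply: le_trans (expR_ge1Dx 1); lra.
exists (1 + A1 + C%:R); first by rewrite !addr_ge0.
have C0 : 0 <= C%:R :> R by [].
elim=> [|n IH]; first by rewrite /qden /den /= ln1 !mulr_ge0// !addr_ge0.
have [_ h] := qden_prefS n Xx.
have D1 := qden_ge1 R (prime_pref n Xx); have D2 := qden_ge1 R (prime_pref n.+1 Xx).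
have p0 : 0 < (digit x n)%:R :> R by rewrite ltr0n prime_gt0// prime_digit.
have Dp : 0 < qden R (pref n x) by lra.
have Dp2 : 0 < qden R (pref n.+1 x) by lra.
have : ln (qden R (pref n.+1 x)) <= ln (2 * (digit x n)%:R * qden R (pref n x)).
  by rewrite ler_ln ?posrE ?mulr_gt0.
rewrite lnM ?posrE ?mulr_gt0// lnM ?posrE// => h2.
have h3 := dig n.
rewrite -[n.+2%:R]natr1; set m : R := n.+1%:R in IH h3 *.
have m1 : 1 <= m by rewrite ler1n.
have E : (1 + A1 + C%:R) * (m + 1) ^+ 2 =
  (1 + A1 + C%:R) * m ^+ 2 + (1 + A1 + C%:R) * (2 * m + 1) by ring.
have h4 : 1 + A1 + C%:R * m <= (1 + A1 + C%:R) * (2 * m + 1) by nra.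
by rewrite E; lra.
Qed.

Lemma lower_density : (Rk R 1 < +oo)%E -> (0 < Rk R 2)%E ->
  exists (c : R) (N : set R), [/\ 0 < c, measurable N, mu N = 0%E &
    forall x eps, ~ N x -> 0 < eps -> exists r, [/\ 0 < r, 2 * r <= eps &
     (mu (closed_ball x (5 * r)) <= (c * psi_dim delta (2 * r))%:E)%E]].
Proof.
move=> R1 R2; have [c1 c10 iso] := isolated_primes R1 R2.
have [C [N1 [mN1 N10 growth]]] := digit_growth cmu.
pose S := [set p | exists g, isolated c1 p g].
have [||N2 [mN2 N20 hit]] := @hitting _ _ _ cmu S.
- by move=> p [g []].
- by move=> M; have [p [g [pp Mp g2 cg q]]] := iso M; exists p => //; exists g.
have d0 : 0 < delta by have := delta_gt_half cmu; lra.
have k0 := distortion_gt0 delta.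
(* The 200 comes from 2r = g/(200 p^2 q^2), the 49 from log log(1/(2r)) <= 7 ln p, and c1 from g >=
   c1 ln(p)^2. *)
pose c := distortion delta * (200 * 49 / c1) `^ delta.
have c0 : 0 < c by rewrite mulr_gt0// powR_gt0// divr_gt0.
exists c, (N1 `|` N2 `|` ~` X); split=> //.
- apply: measurableU; first exact: measurableU.
  by apply: measurableC; exact: mX.
- have [_ [h2 _]] := cmu.
  have mXC := measurableC mX.
  have m12 : measurable (N1 `|` N2) by exact: measurableU.
  apply/eqP; rewrite -measure_le0.
  have h := measureU2 mu m12 mXC; have h' := measureU2 mu mN1 mN2.
  have [a [b d]] : (mu N1 <= 0 /\ mu N2 <= 0 /\ mu (~` X) <= 0)%E by rewrite N10 N20 h2.
  apply: (le_trans h); rewrite -[leRHS]adde0; apply: leeD => //.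
  by apply: (le_trans h'); rewrite -[leRHS]adde0; apply: leeD.
move=> x eps /not_orP[/not_orP[n1 n2] /contrapT Xx] eps0.
have [n0 hn0] := growth x Xx n1.
have [A A0 hA] := ln_qden_growth Xx hn0.
(* Makes p >= 202 + 2A, used for ln(1/(2r)) <= p^7, and p >= 1/eps, used for 2r <= eps. *)
pose M := maxn (Num.truncn (202 + 2 * A)).+1 (Num.truncn eps^-1).+1.
have [p [n [Mp [g ig] n3 dn]]] := hit x Xx n2 M.
have [pp /andP[g2 gp] cg _] := ig.
have pw := prime_pref n Xx; have D1 := qden_ge1 R pw.
have ball_sub := isolated_ball ig Xx dn.
have hAn := hA n.
have P1 : 202 + 2 * A <= p%:R.
  apply: (le_trans (ltW (truncnS_gt _))); rewrite ler_nat (leq_trans _ Mp)//.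
  exact: leq_maxl.
have P2 : eps^-1 <= p%:R.
  apply: (le_trans (ltW (truncnS_gt _))); rewrite ler_nat (leq_trans _ Mp)//.
  exact: leq_maxr.
have G2 : 2 <= g%:R :> R by rewrite ler_nat.
have GP : g%:R <= p%:R :> R by rewrite ler_nat.
have n3' : n.+1%:R <= p%:R ^+ 3 :> R by rewrite -natrX ler_nat.
have p2 : 2 <= p%:R :> R by rewrite ler_nat prime_gt1.
set w := pref n x in pw D1 ball_sub hAn *; set d := qden R w in D1 ball_sub hAn *.
have mass_b := mass_branchX_le cmu pp.
have lp : 0 < ln p%:R :> R by rewrite ln_gt0//; lra.
set P : R := p%:R in P1 P2 GP n3' p2 mass_b lp cg ball_sub *.
set G : R := g%:R in G2 GP cg ball_sub *.
have P0 : 0 < P by lra.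
have PP : 0 < P ^+ 2 by rewrite exprn_gt0.
have dd0 : 0 < d by lra.
have dd : 0 < d ^+ 2 by rewrite exprn_gt0.
have d21 : 1 <= d ^+ 2 by rewrite expr2; nra.
have G0 : 0 < G by lra.
have den0 : 0 < 400 * P ^+ 2 * d ^+ 2 by rewrite !mulr_gt0.
have P200 : 0 < 200 * P ^+ 2 by rewrite mulr_gt0.
have den200 : 0 < 200 * P ^+ 2 * d ^+ 2 by rewrite mulr_gt0.
pose r := G / (400 * P ^+ 2 * d ^+ 2).
have r0 : 0 < r by rewrite divr_gt0.
have r2E : 2 * r = G / (200 * P ^+ 2 * d ^+ 2).
  by rewrite /r; field; rewrite !gt_eqF.
have r2P : 2 * r <= (200 * P)^-1.
  have -> : (200 * P)^-1 = P / (200 * P ^+ 2) by field; rewrite gt_eqF.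
  rewrite r2E; apply: ler_pM; rewrite ?(ltW G0)//.
    by rewrite invr_ge0 (ltW den200).
  by rewrite lef_pV2 ?posrE// ler_peMr// ltW.
exists r; split=> //.
  apply: (le_trans r2P); rewrite -[leRHS]invrK lef_pV2 ?posrE ?invr_gt0 ?mulr_gt0//.
  lra.
have mBx := measurable_closed_ball x (5 * r).
rewrite (muE cmu)// lee_fin.
have mb := @measurable_branchX R p.
have B1 : mass (closed_ball x (5 * r)) <= mass (cyl w (branch p X)).
  rewrite (mass_setID cmu mBx mX).
  have -> : mass (closed_ball x (5 * r) `\` X) = 0.
    apply/eqP; rewrite eq_le mass_ge0 andbT.
    have [_ [h2 _]] := cmu.
    have -> : 0 = mass (~` X) by have := muE cmu (measurableC mX); rewrite h2 => -[].
    by apply: (le_mass cmu); [exact: (measurableD mBx mX)|exact: (measurableC mX)|move=> z []].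
  rewrite add0r; apply: (le_mass cmu) => //; last exact: measurable_cyl.
  by apply: measurableI => //; exact: mX.
have B2 := mass_cyl_le cmu mb pw; rewrite -/d in B2.
have XB : X `&` branch p X = branch p X.
  by apply/seteqP; split=> [z []//|z bz]; split=> //; case: bz.
rewrite XB in B2.
apply: (le_trans B1); apply: (le_trans B2).
apply: (@le_trans _ _ (distortion delta * d `^ (- (2 * delta)) * P `^ (- (2 * delta)))).
  by rewrite ler_wpM2l// mulr_ge0 ?powR_ge0 ?(ltW k0).
rewrite /psi_dim r2E.
set L := ln (ln _).
have invE : 1 / (G / (200 * P ^+ 2 * d ^+ 2)) = 200 * P ^+ 2 * d ^+ 2 / G.
  by rewrite div1r invf_div.
have big0 : 0 < 200 * P ^+ 2 * d ^+ 2 / G by rewrite divr_gt0 ?mulr_gt0.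
have l2 := ln2_ge_half R.
(* Since 1/(2r) >= 8, the iterated logarithm is positive. *)
have ln8 : 1 < ln (1 / (G / (200 * P ^+ 2 * d ^+ 2))).
  apply: (@lt_le_trans _ _ (ln (2 ^+ 3))).
    by rewrite lnXn// -[_ *+ 3]mulr_natl; lra.
  rewrite invE ler_ln ?posrE// ler_pdivlMr//.
  have h : 8 * G <= 8 * P by rewrite ler_wpM2l.
  have h' : 8 * P <= 200 * P ^+ 2 by rewrite expr2; nra.
  have h'' : 200 * P ^+ 2 <= 200 * P ^+ 2 * d ^+ 2 by rewrite ler_peMr// ltW.
  by rewrite -natrX; lra.
have L0 : 0 < L by rewrite ln_gt0.
have L7 : L <= 7 * ln P.
  have lnP : ln P <= P by rewrite ltW// ln_sublinear.
  have h1 : ln (1 / (G / (200 * P ^+ 2 * d ^+ 2))) <= P ^+ 7.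
    rewrite invE; apply: (@le_trans _ _ (ln (200 * P ^+ 2 * d ^+ 2))).
      have G1 : 1 <= G by lra.
      by rewrite ler_ln ?posrE// ler_pdivrMr// ler_peMr// ltW.
    rewrite lnM ?posrE ?mulr_gt0// lnM ?posrE// !lnXn//.
    have h200 : ln 200 <= 200 :> R by rewrite ltW// ln_sublinear.
    have q6 : A * n.+1%:R ^+ 2 <= A * P ^+ 6.
      rewrite ler_wpM2l// (_ : P ^+ 6 = (P ^+ 3) ^+ 2); last by ring.
      by rewrite lerXn2r ?nnegrE ?exprn_ge0 ?(ltW P0).
    (* With n + 1 <= p^3 the sum ln 200 + 2 ln p + 2 ln q is at most (202 + 2A) p^6. *)
    have P6 : P <= P ^+ 6 by rewrite ler_eXnr//; lra.
    have P61 : 1 <= P ^+ 6 by rewrite exprn_ege1//; lra.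
    have P7 : (202 + 2 * A) * P ^+ 6 <= P ^+ 7.
      by rewrite [P ^+ 7]exprS ler_wpM2r// exprn_ge0// ltW.
    rewrite !mulr2n; lra.
  apply: (@le_trans _ _ (ln (P ^+ 7))).
    by rewrite ler_ln ?posrE ?exprn_gt0//; lra.
  by rewrite lnXn// -[_ *+ 7]mulr_natl.
have L70 : 0 < 7 * ln P by rewrite mulr_gt0.
apply: (@le_trans _ _ (c * ((c1 * ln P ^+ 2 / (200 * P ^+ 2 * d ^+ 2)) `^ delta *
    (7 * ln P) `^ (- (2 * delta))))); last first.
  rewrite ler_wpM2l ?(ltW c0)// ler_pM ?powR_ge0//.
    apply: ge0_ler_powR; rewrite ?nnegrE ?(ltW d0)//.
    - by rewrite divr_ge0 ?(ltW den200)// mulr_ge0 ?sqr_ge0 ?(ltW c10).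
    - by rewrite divr_ge0 ?(ltW den200)// ltW.
    by rewrite ler_wpM2r// invr_ge0 ltW.
  by apply: powR_antimono => //; rewrite mulr_ge0// ltW.
have sqE (z : R) : 0 < z -> z `^ (- (2 * delta)) = ((z ^+ 2)^-1) `^ delta.
  by move=> z0; rewrite -[z ^+ 2]powR_mulrn ?(ltW z0)// -powRN -powRrM; congr (_ `^ _); ring.
rewrite !sqE//.
have l20 : 0 < ln P ^+ 2 by rewrite exprn_gt0.
have e1 : 0 <= 200 * 49 / c1 by rewrite divr_ge0 ?(ltW c10).
have e2 : 0 <= c1 * ln P ^+ 2 / (200 * P ^+ 2 * d ^+ 2).
  exact: divr_ge0 (mulr_ge0 (ltW c10) (ltW l20)) (ltW den200).
have e3 : 0 <= ((7 * ln P) ^+ 2)^-1 by rewrite invr_ge0 sqr_ge0.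
have e4 : 0 <= (d ^+ 2)^-1 by rewrite invr_ge0 ltW.
have e5 : 0 <= (P ^+ 2)^-1 by rewrite invr_ge0 ltW.
rewrite /c -[leLHS]mulrA -[leRHS]mulrA ler_wpM2l ?(ltW k0)//.
rewrite -(powRM _ e4 e5) -(powRM _ e2 e3) -(powRM _ e1 (mulr_ge0 e2 e3)).
rewrite le_eqVlt; apply/orP; left; apply/eqP; congr (_ `^ _).
by field; rewrite !gt_eqF.
Qed.

End LowerDensityMeasure.

(** * Positivity and finiteness from the two density bounds *)

Theorem theorem3 (R : realType) (delta : R) (mu : {measure set R -> \bar R}) :
  (0 < Rk R 1 < +oo)%E ->
  (0 < Rk R 2 < +oo)%E ->
  pressure_zero delta ->
  conformal delta mu ->
  (0 < packing_of_measure (psi_dim delta) mu < +oo)%E.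
Proof.
move=> /andP[_ R1] /andP[R2 _] _ cmu; have [mu1 _] := cmu.
have psi0 r : 0 <= psi_dim delta r by rewrite mulr_ge0 ?powR_ge0.
apply/andP; split.
  have [c [N [c0 mN N0 h]]] := lower_density cmu R1 R2.
  apply: (@lt_le_trans _ _ c^-1%:E); first by rewrite lte_fin invr_gt0.
  apply: le_ereal_inf_tmp => _ [A [mA A0] <-].
  exact: (packing_lower mu1 psi0 c0 mN N0 h).
have [c [N [c0 mN N0 h]]] := upper_density cmu R1.
have [A [mA A0 hA]] := packing_upper mu1 psi0 c0 mN N0 h.
apply: (@le_lt_trans _ _ (2 * c)%:E); last exact: ltry.
by apply: ge_ereal_inf; exists (packing_measure (psi_dim delta) A) => //; exists A.
Qed.
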